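(* Let the constraint function $c$ be deterministic (i.e. $\tilde c(x,\zeta)=c(x)$ and $\tilde\nabla c(x,\zeta)=\nabla c(x)$). Assume that there are positive constants such that for all $x,y\in\mathbb{R}^d$: (i) $\mathbb{E}_\xi\|\tilde\nabla f(x,\xi)-\tilde\nabla f(y,\xi)\|^2\le\tilde L_{\nabla f}^2\|x-y\|^2$, $\|\nabla c(x)-\nabla c(y)\|\le\tilde L_{\nabla c}\|x-y\|$, $\|c(x)-c(y)\|\le\tilde L_c\|x-y\|$; (ii) $\mathbb{E}\|\tilde\nabla f(x,\xi)-\nabla f(x)\|^2\le\sigma_f^2$; (iii) $\|\nabla c(x)\|\le\tilde C_{\nabla c}$, $\|c(x)\|\le\tilde C_c$, $\|\nabla f(x)\|\le C_{\nabla f}$, $|f(x_k)|\le B_f$ for all iterates $x_k$, and $Q_\rho(x)\ge\underline Q>-\infty$ for all $\rho>0$ and all $x$; (iv) there is $\delta>0$ with $\mathrm{dist}(\nabla c(x_k)^\top c(x_k),-N_X(x_k))\ge\delta\|c(x_k)\|$ for all iterates $x_k$. Run the stochastic linearized quadratic penalty algorithm described in the context with $$\eta_k=\frac{1}{9\tilde L\rho(k+1)^{1/2}},\qquad \rho_k=\rho k^{1/4},\qquad \alpha_{k+1}=\frac{72}{81(k+1)^{1/2}},$$ for some constant $\rho>1$, where $\tilde L^2=4\tilde L_{\nabla f}^2+4m^2(\tilde C_c^2\tilde L_{\nabla c}^2+\tilde C_{\nabla c}^2\tilde L_c^2)$. Then there are constants $C,p>0$ independent of $\varepsilon$ such that for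 every $\varepsilon\in(0,1/2]$ there is an integer $K\le C\varepsilon^{-4}(\log(1/\varepsilon))^p$ (that is, $K=\widetilde O(\varepsilon^{-4})$ iterations) such that, with $\hat k$ selected uniformly at random from $\{1,\dots,K\}$ (independently of the run), there exists a (random) $\lambda\in\mathbb{R}^m$ with $$\mathbb{E}\,\mathrm{dist}\big(\nabla f(x_{\hat k+1})+\nabla c(x_{\hat k+1})^\top\lambda,\,-N_X(x_{\hat k+1})\big)\le\varepsilon,\qquad \mathbb{E}\|c(x_{\hat k+1})\|\le\varepsilon .$$
   Context: Problem: $\min_{x\in X}f(x)$ subject to $c(x)=0$, where $X\subseteq\mathbb{R}^d$ is closed and convex, $f:\mathbb{R}^d\to\mathbb{R}$ and $c=(c_1,\dots,c_m)^\top:\mathbb{R}^d\to\mathbb{R}^m$ are smooth (Lipschitz gradients, possibly nonconvex), $f(x)=\mathbb{E}_\xi[\tilde f(x,\xi)]$. $\nabla c(x)\in\mathbb{R}^{m\times d}$ is the Jacobian. An unbiased oracle $\tilde\nabla f(x,\xi)$ with $\mathbb{E}_\xi\tilde\nabla f(x,\xi)=\nabla f(x)$ is given, and $c,\nabla c$ can be evaluated exactly. $N_X(x)$ is the normal cone to $X$ at $x$, $P_X$ is projection onto $X$, $\mathrm{dist}(x,S)=\min_{y\in S}\|x-y\|$. Quadratic penalty function: $Q_\rho(x)=f(x)+\frac{\rho}{2}\sum_{i=1}^m c_i(x)^2$; stochastic gradient $\tilde\nabla Q_\rho(x,\xi)=\tilde\nabla f(x,\xi)+\rho\sum_{i=1}^m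 c_i(x)\nabla c_i(x)$. Algorithm: $x_1\in X$ arbitrary (deterministic), $g_1=\tilde\nabla Q_{\rho_1}(x_1,\xi_1)$. For $k=1,2,\dots$: $x_{k+1}=P_X(x_k-\eta_kg_k)$; draw a fresh independent sample $\xi_{k+1}$; $g_{k+1}=\tilde\nabla Q_{\rho_{k+1}}(x_{k+1},\xi_{k+1})+(1-\alpha_{k+1})\big(g_k-\tilde\nabla Q_{\rho_k}(x_k,\xi_{k+1})\big)$. *)

(* Defs.v *)
From HB Require Import structures.
From mathcomp Require Import all_boot all_order all_algebra finmap.
From mathcomp Require Import all_classical all_reals all_analysis.

Set Implicit Arguments.
Unset Strict Implicit.
Unset Printing Implicit Defensive.

Import Order.TTheory GRing.Theory Num.Theory.
Import numFieldNormedType.Exports.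

Local Open Scope classical_set_scope.
Local Open Scope ring_scope.

(* Vectors of R^n are rows, as in the library's ['J f]: the column A^T v is
   written as the row [v *m A]. *)

Section euclidean.
Context {R : realType}.

Definition dot {n} (u v : 'rV[R]_n) : R := \sum_(i < n) u 0 i * v 0 i.

(* Not the library norm [`|v|] of ['rV[R]_n], which is the maximum norm. *)
Definition enorm {n} (v : 'rV[R]_n) : R := Num.sqrt (dot v v).

(* Spectral norm; the same for [A] and for [A^T]. *)
Definition opnorm {p q} (A : 'M[R]_(p, q)) : R :=
  sup [set enorm (v *m A) | v in [set v : 'rV[R]_p | enorm v <= 1]].

Definition dist {n} (v : 'rV[R]_n) (S : set 'rV[R]_n) : R :=
  inf [set enorm (v - y) | y in S].

(* Meaningful only at points [x] of [X]. *)
Definition normal_cone {n} (X : set 'rV[R]_n) (x : 'rV[R]_n) : set 'rV[R]_n :=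
  [set v | forall y, X y -> dot v (y - x) <= 0].

Definition neg_normal_cone {n} (X : set 'rV[R]_n) (x : 'rV[R]_n) :
    set 'rV[R]_n :=
  [set - v | v in normal_cone X x].

Definition proj {n} (X : set 'rV[R]_n) (y : 'rV[R]_n) : 'rV[R]_n :=
  get [set p | X p /\ forall z, X z -> enorm (y - p) <= enorm (y - z)].

Definition grad {n} (f : 'rV[R]_n -> R) (x : 'rV[R]_n) : 'rV[R]_n :=
  \row_(j < n) 'D_(delta_mx 0 j) f x.

(* The usual m x d Jacobian matrix; ['J c x] acts on rows from the right. *)
Definition jac {d m} (c : 'rV[R]_d -> 'rV[R]_m) (x : 'rV[R]_d) : 'M[R]_(m, d) :=
  ('J c x)^T.

(* R^n with its Borel sigma-algebra. *)
Definition borel_rV n := g_sigma_algebraType (@open 'rV[R]_n).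

End euclidean.
Arguments borel_rV : clear implicits.

Section independence.
Context {R : realType} {dO : measure_display} {Omega : measurableType dO}.
Variable P : probability Omega R.

Definition mutually_independent {I : choiceType} (D : set I)
    (F : I -> set_system Omega) : Prop :=
  forall (J : {fset I}) (E : I -> set Omega),
    [set` J] `<=` D ->
    (forall i, i \in J -> F i (E i)) ->
    P (\bigcap_(i in [set` J]) E i) = (\prod_(i <- J) P (E i))%E.

Definition independent (F G : set_system Omega) : Prop :=
  forall A B, F A -> G B -> P (A `&` B) = (P A * P B)%E.

Context {dX : measure_display} {Xi : measurableType dX}.

(* The samples are xi_1, xi_2, ...; [xi 0] is unused. *)
Definition iid_samples (mu : probability Xi R) (xi : nat -> Omega -> Xi) : Prop :=
  [/\ forall k, (1 <= k)%N -> measurable_fun setT (xi k),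
      forall k, (1 <= k)%N -> forall A, measurable A ->
        P (xi k @^-1` A) = mu A
    & mutually_independent [set k | (1 <= k)%N]
        (fun k => g_sigma_algebra_preimage (xi k))].

Definition samples_sigma_algebra (xi : nat -> Omega -> Xi) : set_system Omega :=
  <<s \bigcup_(k in [set k | (1 <= k)%N]) g_sigma_algebra_preimage (xi k) >>.

(* [khat] is uniform on {1, ..., K} and independent of the samples, hence of
   the whole run of an algorithm driven by them. *)
Definition uniform_index (xi : nat -> Omega -> Xi) (K : nat)
    (khat : Omega -> nat) : Prop :=
  [/\ measurable_fun setT khat,
      forall k, (1 <= k <= K)%N -> P (khat @^-1` [set k]) = (K%:R^-1)%:E
    & independent (g_sigma_algebra_preimage khat) (samples_sigma_algebra xi)].

End independence.

Section penalty.
Context {R : realType} {d m : nat}.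

Definition penalty (f : 'rV[R]_d -> R) (c : 'rV[R]_d -> 'rV[R]_m) (rho : R)
    (x : 'rV[R]_d) : R :=
  f x + rho / 2 * \sum_(i < m) c x 0 i ^+ 2.

Definition sgrad_penalty {Xi : Type} (G : 'rV[R]_d -> Xi -> 'rV[R]_d)
    (c : 'rV[R]_d -> 'rV[R]_m) (rho : R) (x : 'rV[R]_d) (s : Xi) : 'rV[R]_d :=
  G x s + rho *: \sum_(i < m) c x 0 i *: grad (fun y => c y 0 i) x.

(* The trajectory of the algorithm along the sample sequence [xi]; all
   sequences are indexed from 1. *)
Record slqp_run {Xi : Type} (X : set 'rV[R]_d)
    (G : 'rV[R]_d -> Xi -> 'rV[R]_d) (c : 'rV[R]_d -> 'rV[R]_m)
    (eta rho alpha : nat -> R) (x1 : 'rV[R]_d) (xi : nat -> Xi)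
    (x g : nat -> 'rV[R]_d) : Prop := SlqpRun {
  run_x1 : x 1 = x1 ;
  run_g1 : g 1 = sgrad_penalty G c (rho 1) x1 (xi 1) ;
  run_x : forall k, (1 <= k)%N -> x k.+1 = proj X (x k - eta k *: g k) ;
  run_g : forall k, (1 <= k)%N ->
    g k.+1 = sgrad_penalty G c (rho k.+1) (x k.+1) (xi k.+1)
             + (1 - alpha k.+1) *:
               (g k - sgrad_penalty G c (rho k) (x k) (xi k.+1)) }.

End penalty.

Section parameters.
Context {R : realType}.

Definition Ltilde (m : nat) (Lf Lgc Lc Cgc Cc : R) : R :=
  Num.sqrt (4 * Lf ^+ 2
            + 4 * m%:R ^+ 2 * (Cc ^+ 2 * Lgc ^+ 2 + Cgc ^+ 2 * Lc ^+ 2)).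

Definition eta_ (L rho : R) (k : nat) : R :=
  1 / (9 * L * rho * k.+1%:R `^ (1 / 2)).

Definition rho_ (rho : R) (k : nat) : R := rho * k%:R `^ (1 / 4).

Definition alpha_ (k : nat) : R := 72 / (81 * k%:R `^ (1 / 2)).

End parameters.

(* Main.v *)
Require Import Defs.
From HB Require Import structures.
From mathcomp Require Import all_boot all_order all_algebra finmap.
From mathcomp Require Import all_classical all_reals all_analysis.
From mathcomp Require Import measurable_realfun.
From mathcomp Require Import ring lra zify.

Set Implicit Arguments.
Unset Strict Implicit.
Unset Printing Implicit Defensive.

Import Order.TTheory GRing.Theory Num.Theory.
Import numFieldNormedType.Exports.

Local Open Scope classical_set_scope.
Local Open Scope ring_scope.

(** Write [h x = c x *m jac c x] for the gradient of half the squared constraint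
    norm, so that the gradient of the penalty function with weight [r] is
    [grad f + r *: h], and let [e k] be the error of the direction [g k] as an
    estimate of that gradient at [x k], for the weight [rho k].

    The constraint is exact, so [h] cancels from the recursion for [g]: the
    error [e k] is that of a momentum estimator of [grad f] alone.  Given the
    past, the fresh sample perturbs the damped error [(1 - alpha) *: e k] by a
    centered noise, whence
      [E |e (k+1)|^2 <= (1 - alpha) E |e k|^2 + 2 alpha^2 sigma^2
                        + 2 Lf^2 E |x (k+1) - x k|^2]
    ([oracle_step], [fresh_step], [error_moment_next]).  Conditioning on the
    past is done by Fubini: the next sample is independent of the sigma-algebra
    generated by the previous ones ([past_indep], [integral_indep]).

    Along a trajectory the projected step decreases the penalty function by
    [4/9 |x (k+1) - x k|^2 / eta] up to [eta/2 |e k|^2] ([step_descent]): the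
    penalty function is [L * rho k]-smooth and [L * rho k * eta k <= 1/9].  The
    residual of the optimality condition of the projection controls the distance
    of the gradient at the new point to the opposite normal cone
    ([step_dist]), and by the regularity assumption it also controls the
    infeasibility multiplied by [rho k] ([step_constraint]).  The latter is used
    a second time to pay for the growth of the penalty weight: that growth is
    [O (k^(-3/4))] and the squared infeasibility is [O (k^(-1/2))] times one
    plus the squared residual, so that the total increase is [O (1/k)] plus
    small fractions of the decrease and of the error term
    ([penalty_increment]).

    As [alpha = 8 L rho eta], adding a fixed multiple of the error recursion to
    the descent inequality bounds the sum of [eta k] times the mean square
    residual by a multiple of the harmonic sum ([potential_sum],
    [residual_moments]).  The steps being at least of order [K^(-1/2)] up to
    time [K], the mean square residual at a uniformly drawn index is
    [O (log K / sqrt K)] ([index_mean]), hence the mean residual is at most a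
    multiple of [eps] once [K] is of order [eps^(-4) log(1/eps)^2]
    ([iteration_count]).  The multiplier is [rho k *: c (x (k+1))] at the random
    index [k]. *)

(** * Euclidean norm of row vectors *)

Section euclid.
Context {R : realType}.
Implicit Types n : nat.

Lemma dotC n (u v : 'rV[R]_n) : dot u v = dot v u.
Proof. by apply: eq_bigr => i _; rewrite mulrC. Qed.

Lemma dotDl n (u v w : 'rV[R]_n) : dot (u + v) w = dot u w + dot v w.
Proof. by rewrite -big_split; apply: eq_bigr => i _; rewrite mxE mulrDl. Qed.

Lemma dotZl n a (u w : 'rV[R]_n) : dot (a *: u) w = a * dot u w.
Proof. by rewrite /dot mulr_sumr; apply: eq_bigr => i _; rewrite mxE mulrA. Qed.

Lemma dotNl n (u w : 'rV[R]_n) : dot (- u) w = - dot u w.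
Proof. by rewrite -scaleN1r dotZl mulN1r. Qed.

Lemma dotDr n (u v w : 'rV[R]_n) : dot w (u + v) = dot w u + dot w v.
Proof. by rewrite dotC dotDl !(dotC w). Qed.

Lemma dotZr n a (u w : 'rV[R]_n) : dot w (a *: u) = a * dot w u.
Proof. by rewrite dotC dotZl (dotC w). Qed.

Lemma dotNr n (u w : 'rV[R]_n) : dot w (- u) = - dot w u.
Proof. by rewrite dotC dotNl (dotC w). Qed.

Lemma dot0l n (w : 'rV[R]_n) : dot 0 w = 0.
Proof. by rewrite -(scale0r 0) dotZl mul0r. Qed.

Lemma dot0r n (w : 'rV[R]_n) : dot w 0 = 0.
Proof. by rewrite dotC dot0l. Qed.

Definition dotE := (dotDl, dotDr, dotNl, dotNr, dotZl, dotZr).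

Lemma dot_ge0 n (v : 'rV[R]_n) : 0 <= dot v v.
Proof. by apply: sumr_ge0 => i _; rewrite -expr2 sqr_ge0. Qed.

Lemma enorm_ge0 n (v : 'rV[R]_n) : 0 <= enorm v.
Proof. exact: sqrtr_ge0. Qed.

Lemma sqr_enorm n (v : 'rV[R]_n) : enorm v ^+ 2 = dot v v.
Proof. by rewrite sqr_sqrtr // dot_ge0. Qed.

Lemma enorm0 n : enorm (0 : 'rV[R]_n) = 0.
Proof. by rewrite /enorm dot0l sqrtr0. Qed.

Lemma coord_le_enorm n (v : 'rV[R]_n) i : `|v 0 i| <= enorm v.
Proof.
rewrite -sqrtr_sqr ler_wsqrtr // /dot (bigD1 i) //= expr2 lerDl.
by apply: sumr_ge0 => j _; rewrite -expr2 sqr_ge0.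
Qed.

Lemma enorm0_eq0 n (v : 'rV[R]_n) : enorm v = 0 -> v = 0.
Proof.
move=> v0; apply/rowP => i; rewrite mxE.
by apply/eqP; rewrite -normr_le0 -v0 coord_le_enorm.
Qed.

Lemma enormZ n a (v : 'rV[R]_n) : enorm (a *: v) = `|a| * enorm v.
Proof.
by rewrite /enorm !dotE mulrA -expr2 sqrtrM ?sqr_ge0 // sqrtr_sqr.
Qed.

Lemma enormN n (v : 'rV[R]_n) : enorm (- v) = enorm v.
Proof. by rewrite -scaleN1r enormZ normrN1 mul1r. Qed.

Lemma enormB n (u v : 'rV[R]_n) : enorm (u - v) = enorm (v - u).
Proof. by rewrite -enormN opprB. Qed.

(** Cauchy-Schwarz, from the nonnegativity of the squared norm of
    [enorm v *: u - enorm u *: v]. *)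
Lemma dot_le n (u v : 'rV[R]_n) : dot u v <= enorm u * enorm v.
Proof.
have := enorm_ge0 u; rewrite le_eqVlt => /predU1P[/esym u0|u0].
  by rewrite u0 (enorm0_eq0 u0) dot0l mul0r.
have := enorm_ge0 v; rewrite le_eqVlt => /predU1P[/esym v0|v0].
  by rewrite v0 (enorm0_eq0 v0) dot0r mulr0.
have := dot_ge0 (enorm v *: u - enorm u *: v).
rewrite !dotE (dotC v u) -!sqr_enorm => h.
rewrite -(ler_pM2l (mulr_gt0 u0 v0)); lra.
Qed.

Lemma enormD n (u v : 'rV[R]_n) : enorm (u + v) <= enorm u + enorm v.
Proof.
rewrite -ler_sqr ?nnegrE ?addr_ge0 ?enorm_ge0 //.
rewrite sqr_enorm !dotE (dotC v u) -!sqr_enorm.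
have := dot_le u v; nra.
Qed.

Lemma sqr_enormD n (u v : 'rV[R]_n) :
  enorm (u + v) ^+ 2 = enorm u ^+ 2 + 2 * dot u v + enorm v ^+ 2.
Proof. by rewrite !sqr_enorm !dotE (dotC v u); ring. Qed.

Lemma sqr_enormBZ n (u v : 'rV[R]_n) t :
  enorm (u - t *: v) ^+ 2
  = enorm u ^+ 2 - 2 * t * dot u v + t ^+ 2 * enorm v ^+ 2.
Proof. by rewrite !sqr_enorm !dotE (dotC v u); ring. Qed.

Lemma enormD_sqr n (u v : 'rV[R]_n) :
  enorm (u + v) ^+ 2 <= 2 * enorm u ^+ 2 + 2 * enorm v ^+ 2.
Proof.
have := dot_ge0 (u - v); rewrite !sqr_enorm !dotE (dotC v u); lra.
Qed.

Lemma norm_le_enorm n (v : 'rV[R]_n) : `|v| <= enorm v.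
Proof.
rewrite [leLHS]mx_normrE; apply: bigmax_le; first exact: enorm_ge0.
by move=> [i j] _ /=; rewrite (ord1 i) coord_le_enorm.
Qed.

Lemma continuous_coord_dot n (T : topologicalType) (F H : T -> 'rV[R]_n) :
  continuous F -> continuous H -> continuous (fun x => dot (F x) (H x)).
Proof.
move=> cF cH x; rewrite /dot.
apply: (@cvg_big _ _ +%R 0) => [|i _]; first exact: add_continuous.
by apply: cvgM; [apply: (cvg_comp _ (fun M : 'rV[R]_n => M 0 i) (cF x))
                |apply: (cvg_comp _ (fun M : 'rV[R]_n => M 0 i) (cH x))];
   exact: coord_continuous.
Qed.

Lemma continuous_enorm n (T : topologicalType) (F : T -> 'rV[R]_n) :
  continuous F -> continuous (fun x => enorm (F x)).
Proof.
move=> cF x; apply: (cvg_comp _ (fun r : R => Num.sqrt r)).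
  exact: continuous_coord_dot.
exact: sqrt_continuous.
Qed.

Lemma lipschitz_continuous n p (F : 'rV[R]_n -> 'rV[R]_p) (L : R) :
  (forall x y, enorm (F x - F y) <= L * enorm (x - y)) -> continuous F.
Proof.
move=> FL x; apply/(@cvgrPdist_le _ _ _ (nbhs x) (nbhs_filter x)) => e e0.
have cL : (fun y => L * enorm (x - y)) @ x --> L * enorm (x - x).
  apply: (@continuousM R 'rV[R]_n (fun=> L) (fun y => enorm (x - y)) x).
    exact: cst_continuous.
  apply: (@continuous_enorm n 'rV[R]_n (fun y => x - y)) => y.
  apply: (@continuousB R 'rV[R]_n 'rV[R]_n (fun=> x) id y).
    exact: cst_continuous.
  by move=> U.
rewrite subrr enorm0 mulr0 in cL.
move/(@cvgrPdist_le _ _ _ (nbhs x) (nbhs_filter x)): cL => /(_ e e0); apply: filterS => y.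
rewrite sub0r normrN => Le; apply: (le_trans (norm_le_enorm _)).
by apply: (le_trans (FL _ _)); apply: le_trans Le; rewrite ler_norm.
Qed.

End euclid.

(** * Operator norm, distance to a set, and projection onto a closed convex set *)

Section geometry.
Context {R : realType}.

(** Boundedness makes the supremum that defines the spectral norm a genuine
    one; the row norms add up to an upper bound. *)
Lemma opnorm_has_ub p q (A : 'M[R]_(p, q)) :
  has_ubound [set enorm (v *m A) | v in [set v : 'rV[R]_p | enorm v <= 1]].
Proof.
exists (\sum_i enorm (row i A)) => _ [v v1 <-].
have -> : v *m A = \sum_i v 0 i *: row i A by rewrite mulmx_sum_row.
apply: (le_trans (y := \sum_i enorm (v 0 i *: row i A))).
  elim/big_rec2: _ => [|i a u _ ua]; first by rewrite enorm0.
  by rewrite (le_trans (enormD _ _)) // lerD2l.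
apply: ler_sum => i _; rewrite enormZ ler_piMl ?enorm_ge0 //.
by rewrite (le_trans (coord_le_enorm _ _)).
Qed.

Lemma opnorm_mul p q (A : 'M[R]_(p, q)) v :
  enorm (v *m A) <= opnorm A * enorm v.
Proof.
have := enorm_ge0 v; rewrite le_eqVlt => /predU1P[/esym v0|v0].
  by rewrite v0 (enorm0_eq0 v0) mul0mx enorm0 mulr0.
rewrite -ler_pdivrMr // mulrC.
have -> : (enorm v)^-1 * enorm (v *m A) = enorm (((enorm v)^-1 *: v) *m A).
  by rewrite -scalemxAl enormZ gtr0_norm // invr_gt0.
apply: ub_le_sup; first exact: opnorm_has_ub.
exists ((enorm v)^-1 *: v) => //=.
by rewrite enormZ gtr0_norm ?invr_gt0 // mulVf // gt_eqF.
Qed.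

Lemma dist_has_lb n (v : 'rV[R]_n) S : has_lbound [set enorm (v - y) | y in S].
Proof. by exists 0 => _ [y _ <-]; exact: enorm_ge0. Qed.

Lemma dist_le n (v : 'rV[R]_n) (S : set 'rV[R]_n) y :
  S y -> dist v S <= enorm (v - y).
Proof. by move=> Sy; apply: ge_inf; [exact: dist_has_lb|exists y]. Qed.

Lemma dist_ge0 n (v : 'rV[R]_n) (S : set 'rV[R]_n) : 0 <= dist v S.
Proof.
have [->|S0] := eqVneq S set0; first by rewrite /dist image_set0 inf0.
apply: lb_le_inf; last by move=> _ [y _ <-]; exact: enorm_ge0.
by have /set0P[y Sy] := S0; exists (enorm (v - y)), y.
Qed.

Lemma normal_coneZ n X (x v : 'rV[R]_n) a : 0 <= a ->
  normal_cone X x v -> normal_cone X x (a *: v).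
Proof. by move=> a0 Nv y Xy; rewrite dotZl mulr_ge0_le0 // Nv. Qed.

(** A cone is invariant under scaling, so distances to it scale with the point;
    changing the point by [u] costs at most [enorm u]. *)
Lemma dist_cone_perturb n X (x v u w : 'rV[R]_n) a : 0 <= a ->
  normal_cone X x w ->
  a * dist v (neg_normal_cone X x) <= enorm (a *: v + u + w) + enorm u.
Proof.
move=> a0 Nw; have := a0; rewrite le_eqVlt => /predU1P[<-|{}a0].
  by rewrite mul0r addr_ge0 ?enorm_ge0.
apply: (le_trans (y := enorm (a *: v + w))).
  have Nw' : neg_normal_cone X x (- (a^-1 *: w)).
    by exists (a^-1 *: w) => //; apply: normal_coneZ; rewrite ?invr_ge0 ?ltW.
  rewrite -(gtr0_norm a0) (le_trans (ler_wpM2l (normr_ge0 _) (dist_le _ Nw'))) //.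
  by rewrite -enormZ opprK scalerDr scalerA divff ?scale1r ?gt_eqF // gtr0_norm.
rewrite -[X in enorm X <= _](addrK u) (le_trans (enormD _ _)) // enormN.
by rewrite addrAC.
Qed.

Section projection.
Variables (n : nat) (X : set 'rV[R]_n).
Hypotheses (X_closed : closed X) (X_nonempty : X !=set0).
Hypothesis X_convex : convex_set (X : set (convex_lmodType 'rV[R]_n)).

(** The nearest point is sought among the points of [X] that are at least as
    close to [y] as a given one; these form a compact set. *)
Lemma projP y : X (Defs.proj X y) /\
  forall z, X z -> enorm (y - Defs.proj X y) <= enorm (y - z).
Proof.
have [x0 Xx0] := X_nonempty.
have cont : continuous (fun z : 'rV[R]_n => enorm (y - z)).
  apply: (@continuous_enorm R n 'rV[R]_n (fun z => y - z)) => z.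
  apply: (@continuousB R 'rV[R]_n 'rV[R]_n (fun=> y) id z); last by move=> U.
  exact: cst_continuous.
pose A := X `&` [set z | enorm (y - z) <= enorm (y - x0)].
have A0 : A !=set0 by exists x0; split => /=.
have Ac : compact A.
  apply: bounded_closed_compact.
    exists (enorm y + enorm (y - x0)); split; first exact: num_real.
    move=> r hr z [_ /= hz]; apply: (le_trans (norm_le_enorm _)).
    rewrite -[z](subKr y) (le_trans (enormD _ _)) // enormN.
    by rewrite (le_trans _ (ltW hr)) // lerD2l.
  apply: closedI => //.
  apply: (@closed_comp 'rV[R]_n R (fun z => enorm (y - z))
    [set r | r <= enorm (y - x0)]); last exact: closed_le.
  by move=> z _; exact: cont.
have [p] := EVT_min_rV A0 Ac (continuous_subspaceT cont).
rewrite inE => -[Xp px0] pmin.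
apply: (@getPex _ [set p | X p /\ forall z, X z -> enorm (y - p) <= enorm (y - z)]).
exists p; split => // z Xz.
have [zx0|/ltW zx0] := leP (enorm (y - z)) (enorm (y - x0)).
  by apply: pmin; rewrite inE.
exact: le_trans zx0.
Qed.

Lemma proj_in y : X (Defs.proj X y).
Proof. by case: (projP y). Qed.

(** First-order optimality: moving from the projection towards a point [z] of
    [X] by a small step cannot decrease the distance to [y]. *)
Lemma proj_normal y : normal_cone X (Defs.proj X y) (y - Defs.proj X y).
Proof.
move=> z Xz; have [Xp pmin] := projP y; set p := Defs.proj X y in Xp pmin *.
rewrite leNgt; apply/negP => h; set u := y - p in h *; set v := z - p in h *.
have hs (t : R) : 0 < t -> t <= 1 -> 2 * dot u v <= t * dot v v.
  move=> t0 t1; have Xt : X (p + t *: v).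
    have := X_convex (Itv01 (ltW t0) t1) (mem_set Xz) (mem_set Xp).
    rewrite inE; congr (X _); rewrite /conv /=.
    by rewrite /unstable.onem /v scalerBl scale1r scalerBr addrCA.
  have := pmin _ Xt; rewrite opprD addrA -/u -ler_sqr ?nnegrE ?enorm_ge0 //.
  rewrite sqr_enormBZ (sqr_enorm v) => hh.
  by rewrite -(ler_pM2l t0); nra.
have v0 : 0 <= dot v v by exact: dot_ge0.
have := hs 1 ltr01 (lexx _); rewrite mul1r => hv.
have v0' : 0 < dot v v by rewrite (lt_le_trans _ hv) // mulr_gt0.
have := hs (dot u v / dot v v); rewrite divfK ?gt_eqF // divr_gt0 //.
rewrite ler_pdivrMr // mul1r => /(_ isT) hh.
have : 2 * dot u v <= dot u v by apply: hh; lra.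
lra.
Qed.

Lemma proj_nonexpansive y z : enorm (Defs.proj X y - Defs.proj X z) <= enorm (y - z).
Proof.
have := proj_normal y (proj_in z); have := proj_normal z (proj_in y).
set p := Defs.proj X y; set q := Defs.proj X z => hq hp.
have := enorm_ge0 (p - q); rewrite le_eqVlt => /predU1P[<-|pq].
  exact: enorm_ge0.
rewrite -(ler_pM2r pq) -expr2 sqr_enorm (le_trans _ (dot_le _ _)) //.
move: hq hp; rewrite !dotE (dotC q p); lra.
Qed.

Lemma proj_id y : X y -> Defs.proj X y = y.
Proof.
move=> Xy; have [_ /(_ _ Xy)] := projP y; rewrite subrr enorm0 => h.
have /enorm0_eq0 /eqP : enorm (y - Defs.proj X y) = 0.
  by apply/le_anti; rewrite h enorm_ge0.
by rewrite subr_eq0 => /eqP.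
Qed.

End projection.
End geometry.

(** * Gradient of the quadratic penalty and the descent lemma *)

Section calculus.
Context {R : realType}.

Lemma dot_mulmx p q (u : 'rV[R]_p) (v : 'rV[R]_q) (A : 'M[R]_(q, p)) :
  dot u (v *m A) = dot (u *m A^T) v.
Proof.
have dotmx k (a b : 'rV[R]_k) : dot a b = (a *m b^T) 0 0.
  by rewrite mxE; apply: eq_bigr => i _; rewrite mxE.
by rewrite !dotmx trmx_mul mulmxA.
Qed.

Lemma derive_grad d (f : 'rV[R]_d -> R) x v :
  differentiable f x -> 'D_v f x = dot (grad f x) v.
Proof.
move=> fx; rewrite deriveE // {1}[v]row_sum_delta linear_sum /=.
apply: eq_bigr => j _; rewrite linearZ /= mxE deriveE //.
by rewrite mulrC.
Qed.

Lemma derive_coord d m (c : 'rV[R]_d -> 'rV[R]_m) x v i :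
  differentiable c x ->
  is_derive x v (fun y => c y 0 i) ((v *m 'J c x) 0 i).
Proof.
move=> cx; have ci : differentiable (fun y => c y 0 i) x.
  apply: (@differentiable_comp _ _ _ _ c (fun M : 'rV[R]_m => M 0 i)) => //.
  exact: differentiable_coord.
apply: DeriveDef; first exact: diff_derivable.
rewrite -deriveEjacobian //.
by rewrite (derive_mx (diff_derivable cx)) mxE.
Qed.

Lemma sum_grad_jac d m (c : 'rV[R]_d -> 'rV[R]_m) x : differentiable c x ->
  \sum_(i < m) c x 0 i *: grad (fun y => c y 0 i) x = c x *m jac c x.
Proof.
move=> cx; rewrite mulmx_sum_row; apply: eq_bigr => i _; congr (_ *: _).
apply/rowP => j; rewrite !mxE /=.
have Dc := derive_coord (delta_mx 0 j) i cx.
rewrite derive_val.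
by rewrite -rowE !mxE.
Qed.

Definition grad_penalty d m (f : 'rV[R]_d -> R) (c : 'rV[R]_d -> 'rV[R]_m) (r : R) x :=
  grad f x + r *: (c x *m jac c x).

Lemma is_derive_penalty d m (f : 'rV[R]_d -> R) (c : 'rV[R]_d -> 'rV[R]_m) r x v :
  differentiable f x -> differentiable c x ->
  is_derive x v (penalty f c r) (dot (grad_penalty f c r x) v).
Proof.
move=> fx cx; rewrite /penalty.
have Df : is_derive x v f (dot (grad f x) v).
  by apply: DeriveDef; [exact: diff_derivable|exact: derive_grad].
have Dc i := derive_coord v i cx.
have Ds : is_derive x v (fun y => \sum_(i < m) c y 0 i ^+ 2)
    (\sum_(i < m) (2 * c x 0 i) * (v *m 'J c x) 0 i).
  have -> : (fun y => \sum_(i < m) c y 0 i ^+ 2) = \sum_(i < m) (fun y => c y 0 i ^+ 2).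
    by apply/funext => y; rewrite fct_sumE.
  apply: is_derive_sum => i.
  have -> : (fun y => c y 0 i ^+ 2) = (fun y => c y 0 i) * (fun y => c y 0 i).
    by apply/funext => y; rewrite expr2.
  apply: is_derive_eq.
  by rewrite /GRing.scale /= -mulrDl -mulr2n mulr_natl.
have -> : (fun y => f y + r / 2 * \sum_(i < m) c y 0 i ^+ 2) =
  f + (r / 2) \*: (fun y => \sum_(i < m) c y 0 i ^+ 2) by [].
apply: is_derive_eq.
rewrite /grad_penalty dotDl dotZl /jac -dot_mulmx; congr (_ + _).
rewrite /GRing.scale /= -!mulrA; congr (_ * _).
by rewrite mulr_sumr; apply: eq_bigr => i _; rewrite !mulrA mulVf ?pnatr_eq0 // mul1r.
Qed.

(** Along a segment the derivative of [F] differs from its initial value by at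
    most [L * t * enorm (y - x) ^+ 2]; integrating in [t] gives the factor 1/2. *)
Lemma descent_lemma d (F : 'rV[R]_d -> R) (gF : 'rV[R]_d -> 'rV[R]_d) (L : R) :
  (forall x v, is_derive x v F (dot (gF x) v)) ->
  (forall x y, enorm (gF x - gF y) <= L * enorm (x - y)) ->
  forall x y, F y <= F x + dot (gF x) (y - x) + L / 2 * enorm (y - x) ^+ 2.
Proof.
move=> DF LF x y; set v := y - x.
have Dline (t : R) : is_derive t 1 (fun s : R => F (x + s *: v)) (dot (gF (x + t *: v)) v).
  have [dF eF] := DF (x + t *: v) v.
  have E : (fun h : R => h^-1 *: ((F \o shift (x + t *: v)) (h *: v) - F (x + t *: v))) =
    (fun h : R => h^-1 *: (((fun s : R => F (x + s *: v)) \o shift t) (h *: 1) - F (x + t *: v))).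
    apply/funext => h /=; congr (_ *: (F _ - _)).
    by rewrite /GRing.scale /= mulr1 addrCA -scalerDl.
  apply: DeriveDef; first by rewrite /derivable -E.
  by rewrite /derive -E.
pose phi := fun t : R => F (x + t *: v) - (t * dot (gF x) v + (L / 2 * enorm v ^+ 2) * t ^+ 2).
pose dphi := fun t : R => dot (gF (x + t *: v)) v - (dot (gF x) v + L * t * enorm v ^+ 2).
have Dphi (t : R) : is_derive t 1 phi (dphi t).
  rewrite /phi; apply: is_derive_eq.
  rewrite /dphi /GRing.scale /=; lra.
have le : phi 1 <= phi 0.
  have dphi0 (t : R) : t \in `]0, 1[ -> (phi^`())%classic t <= 0.
    rewrite in_itv /= => /andP[t0 _]; rewrite derive1E derive_val /dphi.
    have := dot_le (gF (x + t *: v) - gF x) v.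
    have := LF (x + t *: v) x; rewrite [_ - x in leRHS]addrAC subrr.
    rewrite add0r enormZ gtr0_norm // => h1 h2.
    have := ler_wpM2r (enorm_ge0 v) h1; move: h2; rewrite dotDl dotNl; nra.
  have cphi : {within `[(0 : R), 1], continuous phi}.
    apply: continuous_subspaceT => t.
    by apply/differentiable_continuous/derivable1_diffP.
  by apply: (ler0_derive1_le_cc _ dphi0 cphi) => //; rewrite ?in_itv /= ?lexx ?ler01.
move: le; rewrite /phi !scale0r !scale1r addr0 [x + v]addrC subrK.
rewrite !mul0r !mul1r expr0n expr1n /= !mulr0 mulr1; lra.
Qed.

End calculus.

(** * Borel measurability of vector-valued maps *)

Section borel_vectors.
Context {R : realType}.

(** An open set of [R^n] is the countable union of the rational cubes that it
    contains, so measurability can be tested on coordinates. *)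
Lemma measurable_rV n d0 (T : measurableType d0) (F : T -> borel_rV R n) :
  (forall i, measurable_fun setT (fun w => (F w : 'rV[R]_n) 0 i)) ->
  measurable_fun setT F.
Proof.
move=> mF; apply: (@measurability _ _ T (borel_rV R n) setT F (@open 'rV[R]_n)) => //.
move=> _ [U oU <-]; rewrite setTI.
pose q (p : 'rV[rat]_n * nat) : 'rV[R]_n := map_mx ratr p.1.
pose B p := [set w | forall i, `|q p 0 i - (F w : 'rV[R]_n) 0 i| < p.2.+1%:R^-1].
pose I := [set p | ball (q p) p.2.+1%:R^-1 `<=` U].
have -> : F @^-1` U = \bigcup_p (if p \in I then B p else set0).
  apply/seteqP; split => w; last first.
    move=> [p _]; case: ifPn => // /[!inE] pU Bp.
    by apply: pU; split => [|i j]; rewrite ?invr_gt0 // (ord1 i); exact: Bp.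
  move=> UFw; have /nbhs_ballP[e /= e0 eU] : nbhs (F w : 'rV[R]_n) U.
    exact: open_nbhs_nbhs.
  have [k ke] : exists k : nat, k.+1%:R^-1 < e / 2.
    have e2 : 0 < e / 2 by rewrite divr_gt0.
    exists (Num.truncn (e / 2)^-1); rewrite invf_plt ?posrE ?ltr0n //.
    exact: truncnS_gt.
  have hq i : exists r : rat, `|ratr r - (F w : 'rV[R]_n) 0 i| < k.+1%:R^-1.
    have : (F w : 'rV[R]_n) 0 i - k.+1%:R^-1 < (F w : 'rV[R]_n) 0 i + k.+1%:R^-1.
      by rewrite ltrD2l gtrN // invr_gt0.
    move=> /rat_in_itvoo[r]; rewrite in_itv /= => /andP[r1 r2]; exists r.
    by rewrite ltr_distl r1 r2.
  have [r hr] := choice hq.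
  exists (\row_i r i, k) => //; rewrite ifT; last first.
    rewrite inE => v [_ hv]; apply: eU; split => // i j.
    have := hv i j; have := hr j; rewrite (ord1 i) /q !mxE /= /ball /= => h1 h2.
    rewrite -(subrKA (ratr (r j))) (le_lt_trans (ler_normD _ _)) // distrC.
    by rewrite [e](splitr e) ltrD ?(lt_trans h1) ?(lt_trans h2).
  by move=> i /=; rewrite /q !mxE; exact: hr.
apply: countable_bigcupT_measurable => [|p]; first exact: countableP.
case: ifP => // _.
have -> : B p = \bigcap_(i in [set: 'I_n])
    [set w | `|q p 0 i - (F w : 'rV[R]_n) 0 i| < p.2.+1%:R^-1].
  by apply/seteqP; split => [w Bw i _|w Bw i]; apply: Bw.
apply: fin_bigcap_measurable => // i _.
have m1 : measurable_fun setT (fun w => `|q p 0 i - (F w : 'rV[R]_n) 0 i|).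
  by apply: measurableT_comp => //; apply: measurable_funB.
rewrite -[X in measurable X]setTI.
have -> : [set w | `|q p 0 i - (F w : 'rV[R]_n) 0 i| < p.2.+1%:R^-1] =
  (fun w => `|q p 0 i - (F w : 'rV[R]_n) 0 i|) @^-1` `]-oo, p.2.+1%:R^-1[%classic.
  by apply/seteqP; split => w /=; rewrite in_itv.
by apply: m1 => //; exact: measurable_itv.
Qed.

Lemma continuous_measurable_rVR n (f : 'rV[R]_n -> R) :
  continuous f -> measurable_fun (setT : set (borel_rV R n)) f.
Proof.
move=> /continuousP cf.
apply: (@measurability _ _ (borel_rV R n) _ setT f _ (RGenOpens.measurableE R)).
move=> _ [_ [a [b ->] <-]]; rewrite setTI.
by apply: sub_sigma_algebra; apply: cf; exact: interval_open.
Qed.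

Lemma measurable_coord n i :
  measurable_fun (setT : set (borel_rV R n)) (fun v : 'rV[R]_n => v 0 i).
Proof. by apply: continuous_measurable_rVR; exact: coord_continuous. Qed.

Lemma continuous_measurable_rV n p (F : 'rV[R]_n -> 'rV[R]_p) :
  continuous F ->
  measurable_fun (setT : set (borel_rV R n)) (F : borel_rV R n -> borel_rV R p).
Proof.
move=> /continuousP cF.
apply: (@measurability _ _ (borel_rV R n) (borel_rV R p) setT F (@open 'rV[R]_p)) => //.
by move=> _ [U oU <-]; rewrite setTI; apply: sub_sigma_algebra; exact: cF.
Qed.

Lemma measurable_rV_coord d0 (T : measurableType d0) n (F : T -> borel_rV R n) i :
  measurable_fun setT F -> measurable_fun setT (fun w => (F w : 'rV[R]_n) 0 i).
Proof.
move=> mF.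
exact: (measurableT_comp (measurable_coord i) mF).
Qed.

Lemma measurable_enorm d0 (T : measurableType d0) n (F : T -> 'rV[R]_n) :
  (forall i, measurable_fun setT (fun w => F w 0 i)) ->
  measurable_fun setT (fun w => enorm (F w)).
Proof.
move=> mF.
have c : continuous (@enorm R n).
  by apply: (@continuous_enorm R n 'rV[R]_n id) => x U.
exact: (measurableT_comp (continuous_measurable_rVR c) (measurable_rV mF)).
Qed.

Lemma measurable_addrV d0 (T : measurableType d0) n (F H : T -> 'rV[R]_n) :
  (forall i, measurable_fun setT (fun w => F w 0 i)) ->
  (forall i, measurable_fun setT (fun w => H w 0 i)) ->
  forall i, measurable_fun setT (fun w => (F w + H w) 0 i).
Proof.
move=> mF mH i; under eq_fun do rewrite mxE.
exact: measurable_funD.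
Qed.

Lemma measurable_scalerV d0 (T : measurableType d0) n a (F : T -> 'rV[R]_n) :
  (forall i, measurable_fun setT (fun w => F w 0 i)) ->
  forall i, measurable_fun setT (fun w => (a *: F w) 0 i).
Proof.
move=> mF i; under eq_fun do rewrite mxE.
exact: measurable_funM.
Qed.

Lemma measurable_subrV d0 (T : measurableType d0) n (F H : T -> 'rV[R]_n) :
  (forall i, measurable_fun setT (fun w => F w 0 i)) ->
  (forall i, measurable_fun setT (fun w => H w 0 i)) ->
  forall i, measurable_fun setT (fun w => (F w - H w) 0 i).
Proof.
move=> mF mH i; under eq_fun do rewrite !mxE.
exact: measurable_funB.
Qed.

End borel_vectors.

(** * Independence of a fresh sample from the past *)

Import HBSimple HBNNSimple.

Section joint_law.
Context {R : realType} {dO : measure_display} {Omega : measurableType dO}.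
Variable P : probability Omega R.

(** Under independence the joint law is the product law, so the expectation of
    a nonnegative function of the pair can be taken one variable at a time. *)
Lemma integral_indep d1 d2 (T1 : measurableType d1) (T2 : measurableType d2)
    (m2 : probability T2 R) (U : Omega -> T1) (V : Omega -> T2)
    (f : T1 * T2 -> \bar R) :
  measurable_fun setT U -> measurable_fun setT V ->
  (forall A B, measurable A -> measurable B ->
     P (U @^-1` A `&` V @^-1` B) = (P (U @^-1` A) * m2 B)%E) ->
  measurable_fun setT f -> (forall z, (0 <= f z)%E) ->
  (\int[P]_w f (U w, V w) = \int[P]_w \int[m2]_y f (U w, y))%E.
Proof.
move=> mU mV indep mf f0.
have mUV : measurable_fun setT (fun w => (U w, V w)) by exact: measurable_fun_pair.
pose U' : {mfun Omega >-> T1} := HB.pack U (isMeasurableFun.Build _ _ _ _ U mU).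
pose W : {mfun Omega >-> (T1 * T2)%type} :=
  HB.pack (fun w => (U w, V w)) (isMeasurableFun.Build _ _ _ _ _ mUV).
transitivity (\int[distribution P W]_z f z)%E.
  by rewrite /distribution ge0_integral_pushforward // preimage_setT.
transitivity (\int[(distribution P U' \x m2)%E]_z f z)%E.
  apply: eq_measure_integral => A mA _; apply/esym.
  by apply: product_measure_unique => // B C mB mC; exact: indep.
rewrite fubini_tonelli1 // ge0_integral_pushforward //.
- exact: measurable_fun_fubini_tonelli_F.
- by move=> y _; exact: integral_ge0.
Qed.

(** The integral of a nonnegative function is a supremum over the simple functions
    below it, and each of these is compared with the measurable majorant [g];
    this bounds the expectation of a distance to the normal cone. *)
Lemma le_integral_majorant (f g : Omega -> \bar R) :
  (forall w, (0 <= f w)%E) -> (forall w, (0 <= g w)%E) ->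
  measurable_fun setT g ->
  (\forall w \ae P, (f w <= g w)%E) ->
  (\int[P]_w f w <= \int[P]_w g w)%E.
Proof.
move=> f0 g0 mg fg; rewrite ge0_integralTE //.
apply: ub_ereal_sup => _ [h hf <-].
rewrite -integralT_nnsfun.
apply: ae_ge0_le_integral => //.
- by move=> w _; rewrite lee_fin; exact: fun_ge0.
- by apply/measurable_EFinP.
- by apply: filterS fg => w fgw _; rewrite (le_trans (hf w)).
Qed.

End joint_law.

Section past.
Context {R : realType} {dO dX : measure_display}.
Context {Omega : measurableType dO} {Xi : measurableType dX}.
Variables (P : probability Omega R) (mu : probability Xi R).
Variable xi : nat -> Omega -> Xi.
Hypothesis xi_iid : iid_samples P mu xi.

Definition past_gen k : set_system Omega :=
  \bigcup_(i in [set i | (1 <= i <= k)%N]) g_sigma_algebra_preimage (xi i).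

(** [Omega] with the sigma-algebra of the first [k] samples, so that
    measurability with respect to the past is plain measurability. *)
Definition past k := g_sigma_algebraType (past_gen k).

Lemma past_gen_measurable k : past_gen k `<=` measurable.
Proof.
have [mxi _ _] := xi_iid; move=> A [i /= /andP[i1 _] [B mB <-]].
by apply: mxi.
Qed.

Lemma past_sub k (A : set Omega) :
  measurable (A : set (past k)) -> measurable A.
Proof.
by apply: smallest_sub; [exact: sigma_algebra_measurable|exact: past_gen_measurable].
Qed.

Lemma past_leq k l (A : set Omega) : (k <= l)%N ->
  measurable (A : set (past k)) -> measurable (A : set (past l)).
Proof.
move=> kl; apply: smallest_sub; first exact: sigma_algebra_measurable.
move=> B [i /= /andP[i1 ik] iB]; apply: sub_sigma_algebra; exists i => //=.
by rewrite i1 (leq_trans ik).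
Qed.

Lemma past_samples k (A : set Omega) :
  measurable (A : set (past k)) -> samples_sigma_algebra xi A.
Proof.
apply: smallest_sub; first exact: smallest_sigma_algebra.
by move=> B [i /= /andP[i1 _] iB]; apply: sub_sigma_algebra; exists i.
Qed.

Lemma measurable_past_sample k : (1 <= k)%N ->
  measurable_fun (setT : set (past k)) (xi k).
Proof.
move=> k1 _ B mB; apply: sub_sigma_algebra; exists k => /=; first by rewrite k1 leqnn.
by exists B.
Qed.

Lemma measurable_past_fun k d' (T : measurableType d') (F : Omega -> T) :
  measurable_fun (setT : set (past k)) F -> measurable_fun setT F.
Proof. by move=> mF mT B mB; apply: (@past_sub k); exact: mF. Qed.

Lemma measurable_past_leq k l d' (T : measurableType d') (F : Omega -> T) :
  (k <= l)%N -> measurable_fun (setT : set (past k)) F ->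
  measurable_fun (setT : set (past l)) F.
Proof. by move=> kl mF mT B mB; apply: past_leq kl _; exact: mF. Qed.

(** The finite intersections of events that depend on one sample each form a
    pi-system generating the past; on it the product rule is the independence
    of the samples, and two finite measures agreeing on a generating pi-system
    agree. *)
Lemma past_indep k (A : set Omega) (B : set Xi) :
  measurable (A : set (past k)) -> measurable B ->
  P (A `&` xi k.+1 @^-1` B) = (P A * mu B)%E.
Proof.
move=> mA mB; have [mxi lxi ixi] := xi_iid.
pose J := [fset i in iota 1 k]%fset.
have JP i : (i \in J) = (1 <= i <= k)%N by rewrite inE /= mem_iota add1n ltnS.
pose ev (E : nat -> set Omega) := forall i, (1 <= i)%N -> g_sigma_algebra_preimage (xi i) (E i).
pose Pi : set_system Omega := [set A | exists2 E, ev E & A = \bigcap_(i in [set` J]) E i].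
have evT : ev (fun=> setT).
  by move=> i i1; exists setT => //; rewrite preimage_setT setIT.
have PiT : Pi setT.
  by exists (fun=> setT) => //; apply/esym/seteqP; split.
have evm E i : ev E -> (1 <= i)%N -> measurable (E i).
  by move=> eE i1; have [C mC <-] := eE i i1; apply: mxi.
have PiI : setI_closed Pi.
  move=> _ _ [E eE ->] [F eF ->]; exists (fun i => E i `&` F i).
    move=> i i1; have [C mC <-] := eE i i1; have [D mD <-] := eF i i1.
    by exists (C `&` D); [exact: measurableI|rewrite preimage_setI !setTI].
  by rewrite bigcapI.
have Pim : Pi `<=` measurable.
  move=> _ [E eE ->]; apply: bigcap_measurableType => i Ji.
  by apply: evm => //; move: Ji; rewrite /= JP => /andP[].
have mxiB : measurable (xi k.+1 @^-1` B).
  by rewrite -[X in measurable X]setTI; apply: mxi.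
have muBfin : (mu B \is a fin_num)%E by exact: fin_num_measure.
have muB0 : 0 <= fine (mu B) by exact: fine_ge0.
pose m1 := mrestr P mxiB.
pose m2 := mscale (NngNum muB0) P.
have gen : <<s Pi >> A.
  move: mA; apply: smallest_sub; first exact: smallest_sigma_algebra.
  move=> C [j /= j1k jC]; apply: sub_sigma_algebra.
  exists (fun i => if i == j then C else setT).
    move=> i i1; case: eqP => [->|_] //.
    exact: evT.
  apply/seteqP; split => [w Cw i _|w /(_ j)]; first by case: ifP.
  by rewrite eqxx; apply; rewrite /= JP.
rewrite muleC -(fineK muBfin) -[LHS]/(m1 A) -[RHS]/(m2 A).
apply: (@g_sigma_algebra_measure_unique _ _ _ Pi Pim (fun=> setT)) => //.
- exact: bigcup_const.
- move=> _ [E eE ->]; rewrite /= /m1 /m2 /= /mscale /mrestr /= fineK // muleC.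
  pose E' i := if i == k.+1 then xi k.+1 @^-1` B else E i.
  have kJ : k.+1 \notin J by rewrite JP ltnn andbF.
  have EJ i : i \in J -> E' i = E i.
    by rewrite /E' => iJ; case: eqP => // ik; move: kJ; rewrite -ik iJ.
  have -> : \bigcap_(i in [set` J]) E i `&` xi k.+1 @^-1` B =
      \bigcap_(i in [set` (k.+1 |` J)%fset]) E' i.
    apply/seteqP; split => w.
      move=> [h1 h2] i /=; rewrite in_fset1U => /orP[/eqP ->|iJ]; rewrite /E' ?eqxx //.
      by case: eqP => // _; exact: (h1 i iJ).
    move=> h; split => [i /= iJ|].
      by rewrite -EJ //; apply: h => /=; rewrite in_fset1U iJ orbT.
    by have := h k.+1; rewrite /E' eqxx; apply => /=; rewrite in_fset1U eqxx.
  rewrite ixi; first last.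
  + move=> i; rewrite in_fset1U /E' => /orP[/eqP ->|iJ].
      by rewrite eqxx; exists B => //; rewrite setTI.
    case: eqP => [->|_]; first by exists B => //; rewrite setTI.
    by apply: eE; move: iJ; rewrite JP => /andP[].
  + by move=> i /=; rewrite in_fset1U => /orP[/eqP ->//|]; rewrite JP => /andP[].
  rewrite ixi; first last.
  + by move=> i; rewrite JP => /andP[i1 _]; apply: eE.
  + by move=> i /=; rewrite JP => /andP[].
  rewrite big_fsetU1 //= {1}/E' eqxx lxi // muleC; congr (_ * _)%E.
  by apply: eq_big_seq => i iJ; rewrite EJ.
- move=> _; rewrite /m1 /mrestr /=.
  apply: (le_lt_trans (probability_le1 _ _)); rewrite ?ltry //.
  exact: measurableI.
Qed.

End past.

(** * Mean values and the stochastic gradient oracle *)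

Section means.
Context {R : realType} {dX : measure_display} {Xi : measurableType dX}.
Variable mu : probability Xi R.

(** Integrability is carried along with the value, so that expectations obey the
    arithmetic of [R]. *)
Definition has_mean (f : Xi -> R) (m : R) :=
  mu.-integrable setT (EFin \o f) /\ (\int[mu]_s (f s)%:E = m%:E)%E.

Lemma has_mean_eq f g m : f =1 g -> has_mean f m -> has_mean g m.
Proof. by move=> /funext ->. Qed.

Lemma has_meanD f g a b :
  has_mean f a -> has_mean g b -> has_mean (fun s => f s + g s) (a + b).
Proof.
move=> [If Ef] [Ig Eg]; split; first exact: (integrableD measurableT If Ig).
by rewrite EFinD -Ef -Eg -(integralD measurableT If Ig).
Qed.

Lemma has_meanZ f a k : has_mean f a -> has_mean (fun s => k * f s) (k * a).
Proof.
move=> [If Ef]; split; first exact: (integrableZl measurableT k If).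
by rewrite EFinM -Ef -(integralZl measurableT If).
Qed.

Lemma has_mean_cst a : has_mean (fun=> a) a.
Proof.
split; first exact: (finite_measure_integrable_cst mu a measurableT).
transitivity (a%:E * mu setT)%E; first exact: (integral_cst mu measurableT a%:E).
by rewrite [mu setT]probability_setT mule1.
Qed.

Lemma has_mean_sum n (f : 'I_n -> Xi -> R) (a : 'I_n -> R) :
  (forall i, has_mean (f i) (a i)) ->
  has_mean (fun s => \sum_i f i s) (\sum_i a i).
Proof.
move=> fa; apply: (has_mean_eq (f := \sum_i f i)).
  by move=> s; rewrite fct_sumE.
elim/big_ind2: _ => [|g b h e gb he|//]; first exact: has_mean_cst.
exact: has_meanD.
Qed.

Lemma has_mean_le (f g : Xi -> R) a b : (forall s, f s <= g s) ->
  has_mean f a -> has_mean g b -> a <= b.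
Proof.
move=> fg [If Ef] [Ig Eg]; rewrite -lee_fin -Ef -Eg.
by apply: le_integral => // s _; rewrite lee_fin.
Qed.

Lemma has_mean_bound (f : Xi -> R) c : measurable_fun setT f -> (forall s, 0 <= f s) ->
  (\int[mu]_s (f s)%:E <= c%:E)%E -> exists2 a, has_mean f a & a <= c.
Proof.
move=> mf f0 fc; have If : mu.-integrable setT (EFin \o f).
  apply/integrableP; split; first exact/measurable_EFinP.
  apply: le_lt_trans (ltry c); apply: le_trans fc.
  by under eq_integral do rewrite /= ger0_norm //.
exists (fine (\int[mu]_s (f s)%:E)).
  by split => //; rewrite fineK //; exact: integrable_fin_num If.
by rewrite -lee_fin fineK //; exact: integrable_fin_num If.
Qed.

Lemma has_mean_dominated (f g : Xi -> R) b : measurable_fun setT f ->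
  (forall s, `|f s| <= g s) -> has_mean g b -> exists a, has_mean f a.
Proof.
move=> mf fg [Ig Eg]; have If : mu.-integrable setT (EFin \o f).
  apply: (le_integrable _ _ _ Ig) => //; first exact/measurable_EFinP.
  by move=> s _ /=; rewrite lee_fin (le_trans (fg s)) // ler_norm.
exists (fine (\int[mu]_s (f s)%:E)).
by split => //; rewrite fineK //; exact: integrable_fin_num If.
Qed.

Definition has_vmean n (Z : Xi -> 'rV[R]_n) (m : 'rV[R]_n) :=
  forall j, has_mean (fun s => Z s 0 j) (m 0 j).

Lemma has_vmeanD n (Z W : Xi -> 'rV[R]_n) a b :
  has_vmean Z a -> has_vmean W b -> has_vmean (fun s => Z s + W s) (a + b).
Proof.
move=> hZ hW j; rewrite mxE.
by apply: has_mean_eq (has_meanD (hZ j) (hW j)) => s; rewrite mxE.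
Qed.

Lemma has_vmeanZ n (Z : Xi -> 'rV[R]_n) a k :
  has_vmean Z a -> has_vmean (fun s => k *: Z s) (k *: a).
Proof.
move=> hZ j; rewrite mxE.
by apply: has_mean_eq (has_meanZ k (hZ j)) => s; rewrite mxE.
Qed.

Lemma has_vmean_cst n (a : 'rV[R]_n) : has_vmean (fun=> a) a.
Proof. by move=> j; exact: has_mean_cst. Qed.

Lemma has_vmeanB n (Z W : Xi -> 'rV[R]_n) a b :
  has_vmean Z a -> has_vmean W b -> has_vmean (fun s => Z s - W s) (a - b).
Proof.
move=> hZ hW; have := has_vmeanD hZ (has_vmeanZ (-1) hW).
by rewrite scaleN1r; under eq_fun do rewrite scaleN1r.
Qed.

Lemma has_vmean_measurable n (Z : Xi -> 'rV[R]_n) a :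
  has_vmean Z a -> forall j, measurable_fun setT (fun s => Z s 0 j).
Proof. by move=> hZ j; have [/integrableP[/measurable_EFinP]] := hZ j. Qed.

(** The cross term [2 * dot a Z] averages to zero. *)
Lemma has_mean_sqr_shift n (Z : Xi -> 'rV[R]_n) a v :
  has_vmean Z 0 -> has_mean (fun s => enorm (Z s) ^+ 2) v ->
  has_mean (fun s => enorm (a + Z s) ^+ 2) (enorm a ^+ 2 + v).
Proof.
move=> Z0 Zv; have hdot : has_mean (fun s => dot a (Z s)) 0.
  rewrite -(dot0r a); apply: has_mean_sum => j.
  by apply: has_meanZ; exact: Z0.
rewrite -[enorm a ^+ 2]addr0 -[X in _ + X + _](mulr0 2).
apply: has_mean_eq (has_meanD (has_meanD (has_mean_cst _) (has_meanZ 2 hdot)) Zv) => s.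
by rewrite sqr_enormD.
Qed.

(** The second moment splits into that of the centered variable and the squared
    norm of the mean, by [has_mean_sqr_shift]. *)
Lemma has_mean_sqr_center n (Z : Xi -> 'rV[R]_n) a v :
  has_vmean Z a -> has_mean (fun s => enorm (Z s) ^+ 2) v ->
  has_mean (fun s => enorm (Z s - a) ^+ 2) (v - enorm a ^+ 2).
Proof.
move=> Za Zv; have Zc : has_vmean (fun s => Z s - a) 0.
  by rewrite -(subrr a); apply: has_vmeanB => //; exact: has_vmean_cst.
have [w Zw] : exists w, has_mean (fun s => enorm (Z s - a) ^+ 2) w.
  have hb := has_meanD (has_meanZ 2 Zv) (has_mean_cst (2 * enorm a ^+ 2)).
  apply: has_mean_dominated hb => [|s].
    by apply: measurable_funX; apply: measurable_enorm; exact: has_vmean_measurable Zc.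
  rewrite ger0_norm ?sqr_ge0 // -[in X in _ <= _ + X](enormN a).
  exact: enormD_sqr.
have := has_mean_sqr_shift a Zc Zw.
under eq_fun do rewrite addrC subrK.
move=> [_]; rewrite Zv.2 => -[->]; rewrite [_ + w]addrC addrK.
exact: Zw.
Qed.

Variables (d : nat) (G : 'rV[R]_d -> Xi -> 'rV[R]_d) (gf : 'rV[R]_d -> 'rV[R]_d).
Variables (Lf sigma : R).
Hypothesis Lf_ge0 : 0 <= Lf.
Hypothesis G_meas : forall j : 'I_d, measurable_fun setT
  (fun z : borel_rV R d * Xi => G z.1 z.2 0 j).
Hypothesis G_unbiased : forall x (j : 'I_d),
  ('E_mu[fun s => G x s 0%R j] = (gf x 0%R j)%:E)%E.
Hypothesis G_lip : forall x y,
  ('E_mu[fun s => (enorm (G x s - G y s) ^+ 2)%R]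
     <= (Lf ^+ 2 * enorm (x - y)%R ^+ 2)%:E)%E.
Hypothesis G_var : forall x,
  ('E_mu[fun s => (enorm (G x s - gf x) ^+ 2)%R] <= (sigma ^+ 2)%:E)%E.

Lemma oracle_measurable x j : measurable_fun setT (fun s => G x s 0 j).
Proof.
have mp : measurable_fun setT (fun s : Xi => (x : borel_rV R d, s)).
  by apply: measurable_fun_pair => //; exact: measurable_cst.
exact: (measurableT_comp (G_meas j) mp).
Qed.

Lemma oracle_centered_measurable x j :
  measurable_fun setT (fun s => (G x s - gf x) 0 j).
Proof.
by apply: measurable_subrV => // i; exact: oracle_measurable.
Qed.

Lemma oracle_variance x :
  exists2 v, has_mean (fun s => enorm (G x s - gf x) ^+ 2) v & v <= sigma ^+ 2.
Proof.
apply: has_mean_bound.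
- apply: measurable_funX; apply: measurable_enorm.
  exact: oracle_centered_measurable.
- by move=> s; exact: sqr_ge0.
- by have := G_var x; rewrite unlock.
Qed.

(** The variance bound is what makes the oracle integrable. *)
Lemma oracle_vmean x : has_vmean (G x) (gf x).
Proof.
move=> j; split; last by have := G_unbiased x j; rewrite unlock.
have [v [Iv _] _] := oracle_variance x.
have Ib : mu.-integrable setT
    (EFin \o (fun s => enorm (G x s - gf x) ^+ 2 + (1 + enorm (gf x)))).
  exact: (integrableD measurableT Iv
    (finite_measure_integrable_cst mu (1 + enorm (gf x)) measurableT)).
apply: (le_integrable _ _ _ Ib) => //.
  by apply/measurable_EFinP; exact: oracle_measurable.
move=> s _ /=; rewrite lee_fin; apply: le_trans (ler_norm _).
rewrite -[G x s](subrK (gf x)) (le_trans (coord_le_enorm _ _)) //.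
rewrite (le_trans (enormD _ _)) // addrK addrA lerD2r.
have := enorm_ge0 (G x s - gf x); set e := enorm _; nra.
Qed.

Lemma oracle_increment x y : exists2 v,
  has_mean (fun s => enorm (G y s - G x s) ^+ 2) v
  & v <= Lf ^+ 2 * enorm (y - x) ^+ 2.
Proof.
apply: has_mean_bound.
- apply: measurable_funX; apply: measurable_enorm; apply: measurable_subrV;
  exact: oracle_measurable.
- by move=> s; exact: sqr_ge0.
- by have := G_lip y x; rewrite unlock.
Qed.

(** Jensen: the mean inherits the mean-square Lipschitz constant. *)
Lemma mean_lipschitz x y : enorm (gf x - gf y) <= Lf * enorm (x - y).
Proof.
rewrite -ler_sqr ?nnegrE ?mulr_ge0 ?enorm_ge0 // exprMn.
have [v hv] := oracle_increment y x; apply: le_trans.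
have h0 := has_mean_sqr_center (has_vmeanB (oracle_vmean x) (oracle_vmean y)) hv.
rewrite -subr_ge0; apply: has_mean_le (has_mean_cst 0) h0 => s.
exact: sqr_ge0.
Qed.

(** One step of the recursive estimator adds to the damped error [a] a centered
    noise, made of the fresh oracle error, weighted by [al], and of the
    fluctuation of the oracle increment, which is small when the step is. *)
Lemma oracle_step (a x y : 'rV[R]_d) (al : R) : 0 <= al -> al <= 1 ->
  (\int[mu]_s (enorm (a + (al *: (G y s - gf y)
       + (1 - al) *: ((G y s - G x s) - (gf y - gf x)))) ^+ 2)%:E
   <= (enorm a ^+ 2 + 2 * al ^+ 2 * sigma ^+ 2
       + 2 * Lf ^+ 2 * enorm (y - x) ^+ 2)%:E)%E.
Proof.
move=> al0 al1.
have [vA hA vAs] := oracle_variance y.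
have [vD hD vDL] := oracle_increment x y.
have mD := has_vmeanB (oracle_vmean y) (oracle_vmean x).
have hB := has_mean_sqr_center mD hD.
have mA : has_vmean (fun s => G y s - gf y) 0.
  by rewrite -(subrr (gf y)); apply: has_vmeanB; [exact: oracle_vmean|exact: has_vmean_cst].
have mB : has_vmean (fun s => (G y s - G x s) - (gf y - gf x)) 0.
  by rewrite -(subrr (gf y - gf x)); apply: has_vmeanB => //; exact: has_vmean_cst.
have mN := has_vmeanD (has_vmeanZ al mA) (has_vmeanZ (1 - al) mB).
rewrite !scaler0 addr0 in mN.
have hb := has_meanD (has_meanZ (2 * al ^+ 2) hA) (has_meanZ (2 * (1 - al) ^+ 2) hB).
have dom s : enorm (al *: (G y s - gf y) + (1 - al) *: ((G y s - G x s) - (gf y - gf x))) ^+ 2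
    <= 2 * al ^+ 2 * enorm (G y s - gf y) ^+ 2
       + 2 * (1 - al) ^+ 2 * enorm ((G y s - G x s) - (gf y - gf x)) ^+ 2.
  apply: (le_trans (enormD_sqr _ _)).
  by rewrite !enormZ !exprMn !real_normK ?num_real // !mulrA.
have [vN hN] : exists v, has_mean (fun s => enorm (al *: (G y s - gf y)
     + (1 - al) *: ((G y s - G x s) - (gf y - gf x))) ^+ 2) v.
  apply: has_mean_dominated hb => [|s].
    by apply: measurable_funX; apply: measurable_enorm; exact: has_vmean_measurable mN.
  by rewrite ger0_norm ?sqr_ge0.
have vNle := has_mean_le dom hN hb.
have [_ ->] := has_mean_sqr_shift a mN hN; rewrite lee_fin -addrA lerD2l.
apply: (le_trans vNle); apply: lerD.
  by rewrite ler_wpM2l // mulr_ge0 // sqr_ge0.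
have d0 : 0 <= enorm (gf y - gf x) ^+ 2 by exact: sqr_ge0.
have s0 : 0 <= (1 - al) ^+ 2 by exact: sqr_ge0.
have s1 : (1 - al) ^+ 2 <= 1 by nra.
have v0 : 0 <= Lf ^+ 2 * enorm (y - x) ^+ 2 by rewrite mulr_ge0 // sqr_ge0.
have h1 : (1 - al) ^+ 2 * (vD - enorm (gf y - gf x) ^+ 2)
    <= (1 - al) ^+ 2 * (Lf ^+ 2 * enorm (y - x) ^+ 2) by apply: ler_wpM2l => //; lra.
have h2 := ler_piMl v0 s1.
lra.
Qed.

End means.

(** * Powers of integers and harmonic sums *)

Section parameters.
Context {R : realType}.

Lemma natr_powR_sqr (k : nat) : (k%:R `^ (1 / 2) : R) ^+ 2 = k%:R.
Proof. by rewrite -powR_mulrn ?powR_ge0 // -powRrM mul1r mulVf // powRr1. Qed.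

Lemma quarter_powR_sqr (k : nat) : (k%:R `^ (1 / 4) : R) ^+ 2 = k%:R `^ (1 / 2).
Proof.
rewrite -powR_mulrn ?powR_ge0 // -powRrM; congr (_ `^ _).
by lra.
Qed.

Lemma quarter_powR_ge1 (k : nat) : (1 <= k)%N -> 1 <= (k%:R `^ (1 / 4) : R).
Proof.
move=> k1; apply: (le_trans (y := 1 `^ (1 / 4))); first by rewrite powR1.
rewrite ge0_ler_powR ?nnegrE ?ler0n ?ler1n //.
Qed.

Lemma quarter_powR_le (k : nat) : (1 <= k)%N -> (k%:R `^ (1 / 4) : R) <= k%:R.
Proof.
move=> k1; rewrite -[leRHS]powRr1 // ler_powR ?ler1n //.
by lra.
Qed.

(** Bernoulli: [(1 + 1 / k) ^ (1 / 4) <= 1 + 1 / k]. *)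
Lemma quarter_powR_succ (k : nat) : (1 <= k)%N ->
  (k.+1%:R `^ (1 / 4) : R) <= k%:R `^ (1 / 4) + k%:R `^ (1 / 4) / k%:R.
Proof.
move=> k1; have k0 : 0 < k%:R :> R by rewrite ltr0n.
have -> : k.+1%:R = k%:R * (1 + k%:R^-1) :> R.
  by rewrite mulrDr mulr1 divff ?gt_eqF // natr1.
have i0 : 0 < k%:R^-1 :> R by rewrite invr_gt0.
have i1 : 0 <= 1 + k%:R^-1 :> R by rewrite addr_ge0 // ltW.
rewrite (powRM _ (ltW k0) i1).
rewrite [leRHS](_ : _ = k%:R `^ (1 / 4) * (1 + k%:R^-1)); last first.
  by rewrite mulrDr mulr1.
rewrite ler_wpM2l ?powR_ge0 //.
rewrite -[leRHS](powRr1 i1) ler_powR ?lerDl ?ltW //.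
by lra.
Qed.

Lemma harmonic_le_ln (K : nat) : (1 <= K)%N ->
  \sum_(k < K) k.+1%:R^-1 <= 1 + ln (K%:R : R).
Proof.
elim: K => [//|[_ _|K IH _]]; first by rewrite big_ord1 invr1 ln1 addr0.
rewrite big_ord_recr /=; apply: (le_trans (lerD (IH isT) (lexx _))).
rewrite -addrA lerD2l -lerBrDl.
have K1 : 0 < K.+1%:R :> R by rewrite ltr0n.
have K2 : 0 < K.+2%:R :> R by rewrite ltr0n.
have -> : (K.+2%:R : R)^-1 = 1 - K.+1%:R / K.+2%:R.
  move: K2; rewrite -[K.+2%:R]natr1; move: (K.+1%:R : R) K1 => a a0 a1.
  by field; rewrite gt_eqF.
have := @le_ln1Dx R (K.+1%:R / K.+2%:R - 1).
rewrite [1 + _]addrC subrK ln_div ?posrE //.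
have : 0 < K.+1%:R / K.+2%:R :> R by rewrite divr_gt0.
move: (_ / _) => q q0 h; have /h : -1 < q - 1 by lra.
lra.
Qed.

End parameters.

(** * Step sizes, momentum and penalty weights *)

Section step_parameters.
Context {R : realType}.
Variables (L rho delta Cgf Cc : R).
Hypotheses (L_gt0 : 0 < L) (rho_gt1 : 1 < rho) (delta_gt0 : 0 < delta).
Hypothesis Cc_gt0 : 0 < Cc.

Let rho_gt0 : 0 < rho := lt_trans ltr01 rho_gt1.

Lemma step_eta_gt0 k : 0 < eta_ L rho k.
Proof.
by rewrite /eta_ divr_gt0 // !mulr_gt0 // powR_gt0 // ltr0n.
Qed.

Lemma penalty_weight_ge1 k : (1 <= k)%N -> 1 <= rho_ rho k.
Proof.
move=> k1; rewrite /rho_; have := quarter_powR_ge1 (R := R) k1.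
move: rho_gt1; nra.
Qed.

(** The smoothness constant grows like [k ^ (1/4)] while the step decreases like
    [k ^ (- 1/2)], so their product stays bounded. *)
Lemma step_eta_small k : (1 <= k)%N -> L * rho_ rho k * eta_ L rho k <= 1 / 9.
Proof.
move=> k1; rewrite /rho_ /eta_.
have t0 : 0 < k.+1%:R `^ (1 / 2) :> R by rewrite powR_gt0 // ltr0n.
have -> : L * (rho * k%:R `^ (1 / 4)) * (1 / (9 * L * rho * k.+1%:R `^ (1 / 2)))
  = 1 / 9 * (k%:R `^ (1 / 4) / k.+1%:R `^ (1 / 2)).
  by field; rewrite !gt_eqF.
rewrite ler_piMr // ler_pdivrMr // [leRHS]mul1r.
apply: (le_trans (y := k%:R `^ (1 / 2))).
  by apply: ler_powR; [rewrite ler1n|lra].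
by rewrite ge0_ler_powR ?nnegrE ?ler_nat.
Qed.

Lemma momentum_step k : alpha_ k.+1 = 8 * L * rho * eta_ L rho k.
Proof.
have t0 : 0 < k.+1%:R `^ (1 / 2) :> R by rewrite powR_gt0 // ltr0n.
by rewrite /alpha_ /eta_; field; rewrite !gt_eqF.
Qed.

Lemma momentum_gt0 k : 0 < alpha_ k.+1 :> R.
Proof.
by rewrite momentum_step; apply: mulr_gt0 (step_eta_gt0 k); rewrite !mulr_gt0.
Qed.

Lemma momentum_le1 k : alpha_ k.+1 <= 1 :> R.
Proof.
rewrite /alpha_ ler_pdivrMr; last by rewrite mulr_gt0 // powR_gt0 // ltr0n.
have : 1 `^ (1 / 2) <= k.+1%:R `^ (1 / 2) :> R.
  by rewrite ge0_ler_powR ?nnegrE ?ler1n.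
rewrite powR1; lra.
Qed.

Lemma momentum_sqr k : (alpha_ k.+1) ^+ 2 <= (k.+1%:R)^-1 :> R.
Proof.
rewrite /alpha_ invfM mulrA exprMn exprVn natr_powR_sqr ler_piMl ?invr_ge0 //.
lra.
Qed.

(** By regularity the squared infeasibility times half the weight increment at
    step [k] is at most [kappa / k] times a sum of squares. *)
Definition kappa : R := 3 / (2 * delta ^+ 2 * rho).
(** From this index on, [kappa / k] is at most a twentieth of the step size. *)
Definition burn_in : R := 4 * (180 * L * rho * kappa) ^+ 2.
(** Total coefficient of [1 / k] in the increase of the merit function: the first
    term serves after the burn-in, the second one during it. *)
Definition drift : R := kappa * Cgf ^+ 2 + rho * burn_in * Cc ^+ 2 / 2.

Lemma kappa_gt0 : 0 < kappa.
Proof. by rewrite divr_gt0 // !mulr_gt0 // exprn_gt0. Qed.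

Lemma burn_in_ge0 : 0 <= burn_in.
Proof. by apply: mulr_ge0 => //; exact: sqr_ge0. Qed.

Lemma drift_ge0 : 0 <= drift.
Proof.
have h1 := mulr_ge0 (ltW kappa_gt0) (sqr_ge0 Cgf).
have h2 := mulr_ge0 (mulr_ge0 (ltW rho_gt0) burn_in_ge0) (sqr_ge0 Cc).
by rewrite /drift; apply: addr_ge0 => //; exact: divr_ge0.
Qed.

Lemma kappa_le_eta k : (1 <= k)%N -> burn_in <= k%:R ->
  kappa / k%:R <= eta_ L rho k / 20.
Proof.
move=> k1 hk; rewrite /eta_.
have k0 : 0 < k%:R :> R by rewrite ltr0n.
have kp := kappa_gt0.
have t0 : 0 < k.+1%:R `^ (1 / 2) :> R by rewrite powR_gt0 // ltr0n.
have t2 := natr_powR_sqr (R := R) k.+1.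
move: t0 t2; set t := _ `^ _ => t0 t2.
have -> : 1 / (9 * L * rho * t) / 20 = 1 / (180 * L * rho * t).
  by field; rewrite !gt_eqF.
rewrite ler_pdivrMr // mulrC mulrA mulr1 ler_pdivlMr; last by rewrite !mulr_gt0.
have a0 : 0 <= 180 * L * rho * kappa.
  by apply: mulr_ge0 (ltW kp); apply: mulr_ge0 (ltW rho_gt0); apply: mulr_ge0 (ltW L_gt0).
have -> : kappa * (180 * L * rho * t) = 180 * L * rho * kappa * t by ring.
have a1 := mulr_ge0 a0 (ltW t0).
rewrite -(ler_sqr a1 (ltW k0)) exprMn t2.
move: hk; rewrite /burn_in; move: (_ ^+ 2) (sqr_ge0 (180 * L * rho * kappa)) => b b0 hk.
have k1' : 1 <= k%:R :> R by rewrite ler1n.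
rewrite -natr1; nra.
Qed.

(** The growth of the penalty weight from [k] to [k + 1] raises the merit
    function by a multiple of the squared infeasibility.  During a burn-in the
    infeasibility is just bounded; afterwards regularity bounds it by the
    stationarity residual divided by the weight, and the residual part is
    absorbed by the decrease obtained in the step. *)
Lemma penalty_increment k q ee C : (1 <= k)%N -> 0 <= C -> C <= Cc ->
  delta * rho_ rho k * C <= 10 / 9 * (q / eta_ L rho k) + ee + Cgf ->
  (rho_ rho k.+1 - rho_ rho k) / 2 * C ^+ 2
  <= 1 / 9 * (q ^+ 2 / eta_ L rho k) + eta_ L rho k / 20 * ee ^+ 2
     + drift / k%:R.
Proof.
move=> k1 C0 CCc hC.
have k0 : 0 < k%:R :> R by rewrite ltr0n.
have eta0 := step_eta_gt0 k.
have u1 := quarter_powR_ge1 (R := R) k1; have uk := quarter_powR_le (R := R) k1.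
have kap0 := kappa_gt0.
have hinc : rho_ rho k.+1 - rho_ rho k <= rho * (k%:R `^ (1 / 4) / k%:R).
  rewrite /rho_ -mulrBr ler_pM2l //.
  by have := quarter_powR_succ (R := R) k1; lra.
have ik : 0 < k%:R^-1 :> R by rewrite invr_gt0.
have b0 := burn_in_ge0.
have hkappa := @kappa_le_eta k k1.
move: hC; rewrite [X in delta * X]/rho_.
move: (rho_ rho k.+1 - rho_ rho k) hinc => inc hinc.
move: (k%:R `^ (1 / 4)) u1 uk hinc => u u1 uk hinc hC.
move: (eta_ L rho k) eta0 hkappa hC => eta eta0 hkappa hC.
have C2 : 0 <= C ^+ 2 by exact: sqr_ge0.
have hstep := ler_wpM2r C2 hinc.
have q0 := divr_ge0 (sqr_ge0 q) (ltW eta0).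
have e0 := mulr_ge0 (ltW eta0) (sqr_ge0 ee).
have [hk|hk] := ltP k%:R burn_in.
  have h1 : C ^+ 2 <= Cc ^+ 2 by rewrite ler_sqr ?nnegrE // ltW.
  have h2 : u * C ^+ 2 <= burn_in * Cc ^+ 2.
    by apply: ler_pM => //; [exact: le_trans u1|exact: (le_trans uk (ltW hk))].
  have h3 : rho * (u / k%:R) * C ^+ 2 <= rho * burn_in * Cc ^+ 2 / k%:R.
    have -> : rho * (u / k%:R) * C ^+ 2 = rho * (u * C ^+ 2) / k%:R by ring.
    by rewrite ler_pM2r // -mulrA ler_pM2l.
  have h4 : 0 <= kappa * Cgf ^+ 2 / k%:R.
    by apply: divr_ge0 (ltW k0); apply: mulr_ge0 (ltW kap0) (sqr_ge0 _).
  have -> : drift / k%:R = kappa * Cgf ^+ 2 / k%:R + rho * burn_in * Cc ^+ 2 / k%:R / 2.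
    by rewrite /drift; ring.
  lra.
have {}hkappa := hkappa hk.
have d0 : 0 <= delta * (rho * u) * C.
  by rewrite !mulr_ge0 // ?(ltW delta_gt0) ?(ltW rho_gt0) // (le_trans ler01).
have hS : (delta * (rho * u) * C) ^+ 2 <= 3 * (100 / 81 * (q / eta) ^+ 2 + ee ^+ 2 + Cgf ^+ 2).
  apply: (le_trans (y := (10 / 9 * (q / eta) + ee + Cgf) ^+ 2)).
    by rewrite ler_sqr ?nnegrE // (le_trans d0).
  move: (q / eta) => a.
  have := sqr_ge0 (10 / 9 * a - ee); have := sqr_ge0 (10 / 9 * a - Cgf).
  have := sqr_ge0 (ee - Cgf); lra.
have h1 : inc / 2 * C ^+ 2 <= kappa / k%:R * (100 / 81 * (q / eta) ^+ 2 + ee ^+ 2 + Cgf ^+ 2).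
  set S := (_ + Cgf ^+ 2) in hS *.
  apply: (le_trans (y := rho * (u / k%:R) / 2 * C ^+ 2)); first lra.
  have -> : rho * (u / k%:R) / 2 * C ^+ 2
     = (delta * (rho * u) * C) ^+ 2 / (2 * delta ^+ 2 * rho * k%:R * u).
    by field; rewrite ?gt_eqF // (lt_le_trans ltr01).
  rewrite ler_pdivrMr; last first.
    by rewrite !mulr_gt0 ?exprn_gt0 // (lt_le_trans ltr01).
  have -> : kappa / k%:R * S * (2 * delta ^+ 2 * rho * k%:R * u) = 3 * S * u.
    by rewrite /kappa; field; rewrite !gt_eqF.
  have S0 : 0 <= 3 * S by rewrite (le_trans _ hS) // sqr_ge0.
  by rewrite (le_trans hS) // ler_peMr.
have h2 := ler_wpM2r (sqr_ge0 (q / eta)) hkappa.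
have h3 := ler_wpM2r (sqr_ge0 ee) hkappa.
have h4 : eta / 20 * (q / eta) ^+ 2 = 1 / 20 * (q ^+ 2 / eta).
  by field; rewrite gt_eqF.
have h5 : 0 <= rho * burn_in * Cc ^+ 2 / 2 / k%:R.
  apply: divr_ge0 (ltW k0); apply: divr_ge0 => //; apply: mulr_ge0 (sqr_ge0 _).
  exact: mulr_ge0 (ltW rho_gt0) b0.
have -> : drift / k%:R = kappa / k%:R * Cgf ^+ 2 + rho * burn_in * Cc ^+ 2 / 2 / k%:R.
  by rewrite /drift; ring.
lra.
Qed.

End step_parameters.

(** * One step and one trajectory of the method *)

(** One quantity for both goals: the first two terms bound the stationarity
    residual after step [k]; the last one is what the gradient of the objective
    contributes to the infeasibility once divided by the penalty weight. *)
Definition residual {R : realType} {d : nat} (L rho Cgf : R)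
    (x e : nat -> 'rV[R]_d) (k : nat) : R :=
  10 / 9 * (enorm (x k.+1 - x k) / eta_ L rho k) + enorm (e k)
  + Cgf / k%:R `^ (1 / 4).

Section deterministic_step.
Context {R : realType} {d m : nat}.
Variables (X : set 'rV[R]_d) (f : 'rV[R]_d -> R) (c : 'rV[R]_d -> 'rV[R]_m).
Hypothesis X_closed : closed X.
Hypothesis X_convex : convex_set (X : set (convex_lmodType 'rV[R]_d)).
Hypothesis f_diff : forall x, differentiable f x.
Hypothesis c_diff : forall x, differentiable c x.
Variables (Lf Lgc Lc Cgc Cc : R).
Hypotheses (Lf_gt0 : 0 < Lf) (Lgc_gt0 : 0 < Lgc) (Lc_gt0 : 0 < Lc).
Hypotheses (Cgc_gt0 : 0 < Cgc) (Cc_gt0 : 0 < Cc).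
Hypothesis gf_lip : forall x y, enorm (grad f x - grad f y) <= Lf * enorm (x - y).
Hypothesis gc_lip :
  forall x y, opnorm (jac c x - jac c y) <= Lgc * enorm (x - y).
Hypothesis c_lip : forall x y, enorm (c x - c y) <= Lc * enorm (x - y).
Hypothesis gc_bound : forall x, opnorm (jac c x) <= Cgc.
Hypothesis c_bound : forall x, enorm (c x) <= Cc.

Local Notation L := (Ltilde m Lf Lgc Lc Cgc Cc).
Local Notation h := (fun x => c x *m jac c x).

Let tail_ge0 :
  0 <= 4 * m%:R ^+ 2 * (Cc ^+ 2 * Lgc ^+ 2 + Cgc ^+ 2 * Lc ^+ 2).
Proof.
apply: mulr_ge0; first by apply: mulr_ge0 => //; exact: sqr_ge0.
by apply: addr_ge0; apply: mulr_ge0; exact: sqr_ge0.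
Qed.

Lemma sqr_Ltilde : L ^+ 2 = 4 * Lf ^+ 2
  + 4 * m%:R ^+ 2 * (Cc ^+ 2 * Lgc ^+ 2 + Cgc ^+ 2 * Lc ^+ 2).
Proof.
rewrite /Ltilde sqr_sqrtr //; apply: addr_ge0 => //.
by apply: mulr_ge0 => //; exact: sqr_ge0.
Qed.

Lemma four_sqr_Lf_le : 4 * Lf ^+ 2 <= L ^+ 2.
Proof. by rewrite sqr_Ltilde lerDl. Qed.

Lemma Ltilde_gt0 : 0 < L.
Proof.
have := exprn_gt0 2 Lf_gt0.
have := four_sqr_Lf_le; have : 0 <= L by exact: sqrtr_ge0.
by rewrite le_eqVlt => /predU1P[<-|//]; rewrite expr0n /=; lra.
Qed.

Lemma constraint_grad_lip x y :
  enorm (h x - h y) <= (Cc * Lgc + Cgc * Lc) * enorm (x - y).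
Proof.
have -> : h x - h y = c x *m (jac c x - jac c y) + (c x - c y) *m jac c y.
  by rewrite mulmxBr mulmxBl addrA subrK.
have E0 := enorm_ge0 (x - y); have c0 := enorm_ge0 (c x).
have d0 := enorm_ge0 (c x - c y).
have h1 := opnorm_mul (jac c x - jac c y) (c x).
have h2 := opnorm_mul (jac c y) (c x - c y).
have h3 := ler_wpM2r c0 (gc_lip x y).
have h4 := ler_wpM2r d0 (gc_bound y).
have h5 : Lgc * enorm (x - y) * enorm (c x) <= Lgc * enorm (x - y) * Cc.
  by rewrite ler_wpM2l // mulr_ge0 // ltW.
have h6 := ler_wpM2l (ltW Cgc_gt0) (c_lip x y).
rewrite (le_trans (enormD _ _)) //; lra.
Qed.

(** For [r >= 1] the three contributions to the Lipschitz constant add up to at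
    most [r * L], by [(a + b + c) ^ 2 <= 3 (a ^ 2 + b ^ 2 + c ^ 2)]. *)
Lemma grad_penalty_lip r x y : 1 <= r ->
  enorm (grad_penalty f c r x - grad_penalty f c r y) <= L * r * enorm (x - y).
Proof.
move=> r1; have e0 := enorm_ge0 (x - y).
have -> : grad_penalty f c r x - grad_penalty f c r y =
    (grad f x - grad f y) + r *: (h x - h y).
  by rewrite /grad_penalty scalerBr opprD addrACA.
rewrite (le_trans (enormD _ _)) // enormZ ger0_norm; last by lra.
have L0 := Ltilde_gt0; have hL := sqr_Ltilde.
have [m0|m0] := posnP m.
  have -> : h x - h y = 0.
    have z (u : 'rV[R]_m) (A : 'M[R]_(m, d)) : u *m A = 0.
      by apply/rowP => j; rewrite !mxE big1 // => -[i i_lt]; exfalso; move: (i_lt); rewrite m0.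
    by rewrite /= !z subrr.
  rewrite enorm0 mulr0 addr0 (le_trans (gf_lip _ _)) // ler_wpM2r //.
  have hf := four_sqr_Lf_le.
  have : Lf <= L by rewrite -ler_sqr ?nnegrE ?ltW //; nra.
  nra.
have m1 : 1 <= m%:R ^+ 2 :> R by rewrite exprn_ege1 // ler1n.
have hLL : Lf + (Cc * Lgc + Cgc * Lc) <= L.
  have a0 : 0 < Cc * Lgc by rewrite mulr_gt0.
  have b0 : 0 < Cgc * Lc by rewrite mulr_gt0.
  rewrite -ler_sqr ?nnegrE; [|by rewrite !addr_ge0 ?ltW|exact: ltW].
  rewrite hL.
  have := ler_wpM2r (addr_ge0 (sqr_ge0 (Cc * Lgc)) (sqr_ge0 (Cgc * Lc))) m1.
  have := sqr_ge0 (Lf - Cc * Lgc); have := sqr_ge0 (Lf - Cgc * Lc).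
  have := sqr_ge0 (Cc * Lgc - Cgc * Lc); have := sqr_ge0 Lf.
  have := exprn_ge0 2 (ltW a0); have := exprn_ge0 2 (ltW b0); rewrite !exprMn; lra.
have := constraint_grad_lip x y; have := gf_lip x y.
set E := enorm (x - y) in e0 *; move=> h1 h2.
have r0 : 0 <= r by lra.
have h3 := ler_wpM2l r0 h2.
have h4 : Lf * E <= r * (Lf * E) by rewrite ler_peMl // mulr_ge0 // ltW.
have h5 := ler_wpM2l r0 (ler_wpM2r e0 hLL).
lra.
Qed.

Section step.
Variables (r eta : R) (x e : 'rV[R]_d).
Hypotheses (r_ge1 : 1 <= r) (eta_gt0 : 0 < eta) (x_in : X x).
Hypothesis small_step : L * r * eta <= 1 / 9.
Let g := grad_penalty f c r x + e.
Let y := Defs.proj X (x - eta *: g).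

(** The inexactness [e] of the direction costs [enorm e * enorm (y - x)], which
    is split by Young's inequality. *)
Lemma step_descent : penalty f c r y <= penalty f c r x
  - 4 / 9 * (enorm (y - x) ^+ 2 / eta) + eta / 2 * enorm e ^+ 2.
Proof.
have Xn : X !=set0 by exists x.
have := @descent_lemma _ _ (penalty f c r) (grad_penalty f c r) (L * r)
  (fun z v => is_derive_penalty r v (f_diff z) (c_diff z))
  (fun a b => grad_penalty_lip a b r_ge1) x y.
have := proj_normal X_closed Xn X_convex (x - eta *: g) x_in; rewrite -/y.
have -> : x - eta *: g - y = - ((y - x) + eta *: g).
  by rewrite !opprD !opprK addrAC [- y + x]addrC.
have -> : x - y = - (y - x) by rewrite opprB.
set v := y - x; rewrite dotNl dotNr opprK dotDl dotZl /g dotDl -sqr_enorm => hN hD.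
have he := dot_le (- e) v; rewrite dotNl enormN in he.
have v0 := enorm_ge0 v; have e0 := enorm_ge0 e.
set q := dot (grad_penalty f c r x) v in hN hD *.
set ev := enorm v in hN hD he v0 *; set ee := enorm e in he e0 *.
set p := dot e v in hN he.
(* multiply by eta; the quadratic form left over is a square *)
rewrite -subr_ge0 -(pmulr_rge0 _ eta_gt0).
have -> : eta * (penalty f c r x - 4 / 9 * (ev ^+ 2 / eta) + eta / 2 * ee ^+ 2 - penalty f c r y)
   = eta * (penalty f c r x - penalty f c r y) - 4 / 9 * ev ^+ 2 + (eta * ee) ^+ 2 / 2.
  by field; rewrite gt_eqF.
have h1 : eta * penalty f c r y <= eta * (penalty f c r x + q + L * r / 2 * ev ^+ 2).
  by rewrite ler_pM2l.
have h2 : L * r * eta * ev ^+ 2 <= 1 / 9 * ev ^+ 2 by rewrite ler_wpM2r // sqr_ge0.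
have h3 : - (eta * p) <= eta * ee * ev by rewrite -mulrN -mulrA ler_pM2l.
have h4 : 0 <= (eta * ee - ev) ^+ 2 by exact: sqr_ge0.
lra.
Qed.

Let D := 10 / 9 * (enorm (y - x) / eta) + enorm e.

(* the normal vector certified by the projection *)
Let w := eta^-1 *: (x - eta *: g - y).

Lemma step_normal : normal_cone X y w.
Proof.
apply: normal_coneZ; first by rewrite invr_ge0 ltW.
by apply: proj_normal => //; exists x.
Qed.

(** Adding the normal vector cancels the direction [g] used by the step; what
    remains is the variation of the gradient, the error and the rescaled step. *)
Lemma step_residual : enorm (grad_penalty f c r y + w) <= D.
Proof.
have -> : grad_penalty f c r y + w =
    (grad_penalty f c r y - grad_penalty f c r x) + (- e + eta^-1 *: (x - y)).
  have -> : w = eta^-1 *: (x - y) - g.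
    by rewrite /w [x - _ - y]addrAC scalerBr scalerA mulVf ?gt_eqF // scale1r.
  by rewrite /g opprD [_ + (- _ - _)]addrC -!addrA.
rewrite (le_trans (enormD _ _)) // (le_trans (lerD (grad_penalty_lip _ _ r_ge1) (enormD _ _))) //.
rewrite enormN enormZ gtr0_norm ?invr_gt0 // [enorm (x - y)]enormB /D.
have v0 := enorm_ge0 (y - x).
have hLr : L * r <= 1 / 9 / eta by rewrite ler_pdivlMr.
have := ler_wpM2r v0 hLr; rewrite [_^-1 * _]mulrC => h1.
lra.
Qed.

Lemma step_dist :
  dist (grad f y + (r *: c y) *m jac c y) (neg_normal_cone X y) <= D.
Proof.
apply: le_trans step_residual; rewrite -scalemxAl -/(grad_penalty f c r y).
rewrite -[w]opprK; apply: dist_le.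
by exists w => //; exact: step_normal.
Qed.

(** In the gradient of the penalty function the constraint part is weighted by
    [r], so regularity bounds [r] times the infeasibility by the residual plus
    the size of [grad f]. *)
Lemma step_constraint delta Cgf : 0 < delta ->
  (forall x, enorm (grad f x) <= Cgf) ->
  delta * enorm (c y) <= dist (c y *m jac c y) (neg_normal_cone X y) ->
  delta * r * enorm (c y) <= D + Cgf.
Proof.
move=> delta0 hCgf reg.
have r0 : 0 <= r := le_trans ler01 r_ge1.
have := dist_cone_perturb (h y) (grad f y) r0 step_normal.
rewrite [r *: _ + _]addrC -/(grad_penalty f c r y) => hd.
have := lerD step_residual (hCgf y) => hs.
have := ler_wpM2l r0 reg.
rewrite [delta * r]mulrC -mulrA; move/le_trans; apply.
by apply: (le_trans hd).
Qed.

End step.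

Lemma penalty_diff r r' y :
  penalty f c r' y = penalty f c r y + (r' - r) / 2 * enorm (c y) ^+ 2.
Proof.
have -> : enorm (c y) ^+ 2 = \sum_(i < m) c y 0 i ^+ 2.
  by rewrite sqr_enorm; apply: eq_bigr => i _; rewrite expr2.
by rewrite /penalty; ring.
Qed.

Section run.
Variables (rho delta Cgf : R).
Hypotheses (rho_gt1 : 1 < rho) (delta_gt0 : 0 < delta).
Hypothesis gf_bound : forall x, enorm (grad f x) <= Cgf.
Variables x e : nat -> 'rV[R]_d.
Hypothesis x1_in : X (x 1).
Hypothesis x_next : forall k, (1 <= k)%N ->
  x k.+1 = Defs.proj X (x k - eta_ L rho k *:
    (grad_penalty f c (rho_ rho k) (x k) + e k)).

Lemma run_in k : (1 <= k)%N -> X (x k).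
Proof.
case: k => [//|[//|k] _]; rewrite x_next //.
by apply: proj_in => //; exists (x 1%N).
Qed.

Lemma run_step_bound k : (1 <= k)%N -> enorm (x k.+1 - x k) <=
  eta_ L rho k * enorm (grad_penalty f c (rho_ rho k) (x k) + e k).
Proof.
move=> k1; have xk := run_in k1; have Xn : X !=set0 by exists (x k).
rewrite -{1}(proj_id X_closed Xn xk) x_next //.
apply: (le_trans (proj_nonexpansive X_closed Xn X_convex _ _)).
rewrite addrAC subrr add0r enormN enormZ gtr0_norm //.
by apply: step_eta_gt0 => //; exact: Ltilde_gt0.
Qed.

Lemma run_stationarity k : (1 <= k)%N ->
  dist (grad f (x k.+1) + (rho_ rho k *: c (x k.+1)) *m jac c (x k.+1))
    (neg_normal_cone X (x k.+1)) <= residual L rho Cgf x e k.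
Proof.
move=> k1; have := @step_dist (rho_ rho k) (eta_ L rho k) (x k) (e k)
  (penalty_weight_ge1 rho_gt1 k1) (step_eta_gt0 Ltilde_gt0 rho_gt1 k)
  (run_in k1) (step_eta_small Ltilde_gt0 rho_gt1 k1).
rewrite -x_next // => /le_trans; apply; rewrite /residual lerDl.
by rewrite divr_ge0 ?powR_ge0 // (le_trans _ (gf_bound 0)) ?enorm_ge0.
Qed.

Hypothesis regular : forall k, (1 <= k)%N -> delta * enorm (c (x k))
  <= dist (c (x k) *m jac c (x k)) (neg_normal_cone X (x k)).

Lemma run_constraint k : (1 <= k)%N ->
  delta * rho_ rho k * enorm (c (x k.+1))
  <= 10 / 9 * (enorm (x k.+1 - x k) / eta_ L rho k) + enorm (e k) + Cgf.
Proof.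
move=> k1; have := @step_constraint (rho_ rho k) (eta_ L rho k) (x k) (e k)
  (penalty_weight_ge1 rho_gt1 k1) (step_eta_gt0 Ltilde_gt0 rho_gt1 k)
  (run_in k1) (step_eta_small Ltilde_gt0 rho_gt1 k1) delta Cgf delta_gt0 gf_bound.
by rewrite -x_next //; apply; exact: regular.
Qed.

Lemma run_feasibility k : (1 <= k)%N ->
  delta * rho * enorm (c (x k.+1)) <= residual L rho Cgf x e k.
Proof.
move=> k1; have := run_constraint k1; rewrite /residual [X in delta * X]/rho_.
have u1 := quarter_powR_ge1 (R := R) k1; move: (_ `^ _) u1 => u u1.
have a0 : 0 <= enorm (x k.+1 - x k) / eta_ L rho k.
  by rewrite divr_ge0 ?enorm_ge0 // ltW // step_eta_gt0 // Ltilde_gt0.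
have := enorm_ge0 (e k); move: (enorm (e k)) (_ / eta_ _ _ _) a0 => ee a a0 e0 h.
have u0 : 0 < u by exact: lt_le_trans u1.
have ha : a <= a * u by rewrite ler_peMr.
have hee : ee <= ee * u by rewrite ler_peMr.
rewrite -(ler_pM2r u0) mulrDl divfK ?gt_eqF //; lra.
Qed.

(** The trajectory is indexed from 1, hence the shifts in the sums. *)
Lemma run_descent K : penalty f c (rho_ rho K.+1) (x K.+1)
  + \sum_(k < K) 1 / 3 * (enorm (x k.+2 - x k.+1) ^+ 2 / eta_ L rho k.+1)
  <= penalty f c (rho_ rho 1) (x 1)
  + \sum_(k < K) 11 / 20 * (eta_ L rho k.+1 * enorm (e k.+1) ^+ 2)
  + drift L rho delta Cgf Cc * \sum_(k < K) k.+1%:R^-1.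
Proof.
elim: K => [|K IH]; first by rewrite !big_ord0 mulr0 !addr0.
rewrite !big_ord_recr /=.
have eta0 := step_eta_gt0 Ltilde_gt0 rho_gt1 K.+1.
have hd := @step_descent (rho_ rho K.+1) (eta_ L rho K.+1) (x K.+1) (e K.+1)
  (penalty_weight_ge1 rho_gt1 (ltn0Sn K)) eta0
  (run_in (ltn0Sn K)) (step_eta_small Ltilde_gt0 rho_gt1 (ltn0Sn K)).
rewrite -x_next // in hd.
have hp := @penalty_increment R L rho delta Cgf Cc Ltilde_gt0 rho_gt1 delta_gt0
  Cc_gt0 K.+1 _ _ _ (ltn0Sn K) (enorm_ge0 _) (c_bound _) (run_constraint (ltn0Sn K)).
rewrite (penalty_diff (rho_ rho K.+1)).
rewrite mulrDr; move: IH hd hp.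
move: (\sum_(k < K) k.+1%:R^-1) (drift _ _ _ _ _ / _) (enorm (_ - _) ^+ 2 / _).
move: (eta_ L rho K.+1) (enorm (e _) ^+ 2) (_ / 2 * enorm (c _) ^+ 2).
by move=> eta ee cc H dK a; lra.
Qed.

End run.

End deterministic_step.

(** * Combining the descent and the error recursion *)

Section potential.
Context {R : realType}.

Lemma sum_contraction (s b r : nat -> R) K :
  (forall k, s k.+1 <= (1 - b k) * s k + r k) ->
  s K + \sum_(k < K) b k * s k <= s 0%N + \sum_(k < K) r k.
Proof.
move=> hs; elim: K => [|K IH]; first by rewrite !big_ord0.
rewrite !big_ord_recr /=; have := hs K; lra.
Qed.

(** Adding [1 / (8 L rho)] times the summed error recursion to the summed
    descent inequality makes both kinds of terms controlled: since
    [alpha = 8 L rho eta], the weighted error sum exceeds the one produced by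
    the descent, and the increments fed back into the errors are a small
    multiple of those gained by the descent. *)
Lemma potential_sum (L rho V Lf C0 Z : R) (s a : nat -> R) K :
  0 < L -> 1 < rho -> 0 <= V -> 4 * Lf ^+ 2 <= L ^+ 2 ->
  (forall k, 0 <= s k) -> (forall k, 0 <= a k) -> s 0%N <= 2 * V ->
  (forall k, s k.+1 <= (1 - alpha_ k.+2) * s k
    + 2 * alpha_ k.+2 ^+ 2 * V + 2 * Lf ^+ 2 * a k) ->
  \sum_(k < K) 1 / 3 * (a k / eta_ L rho k.+1) <= C0
    + \sum_(k < K) 11 / 20 * (eta_ L rho k.+1 * s k)
    + Z * \sum_(k < K) k.+1%:R^-1 ->
  \sum_(k < K) (1 / 12 * (a k / eta_ L rho k.+1)
                + 9 / 20 * (eta_ L rho k.+1 * s k))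
  <= C0 + V / (4 * L * rho)
     + (Z + V / (4 * L * rho)) * \sum_(k < K) k.+1%:R^-1.
Proof.
move=> L0 rho1 V0 LfL s0 a0 s0V srec hsum.
have rho0 : 0 < rho := lt_trans ltr01 rho1.
have Lrho : 0 < 8 * L * rho by rewrite !mulr_gt0.
have hc : s K + \sum_(k < K) alpha_ k.+2 * s k <= s 0%N
    + \sum_(k < K) (2 * alpha_ k.+2 ^+ 2 * V + 2 * Lf ^+ 2 * a k).
  apply: (sum_contraction K (b := fun k => alpha_ k.+2)
    (r := fun k => 2 * alpha_ k.+2 ^+ 2 * V + 2 * Lf ^+ 2 * a k)) => k.
  by rewrite addrA; exact: srec.
have e1 : \sum_(k < K) alpha_ k.+2 * s k
    = 8 * L * rho * \sum_(k < K) eta_ L rho k.+1 * s k.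
  by rewrite mulr_sumr; apply: eq_bigr => k _; rewrite (momentum_step L0 rho1) !mulrA.
have e2 : \sum_(k < K) (2 * alpha_ k.+2 ^+ 2 * V + 2 * Lf ^+ 2 * a k)
    <= 2 * V * (\sum_(k < K) k.+1%:R^-1)
       + 8 * L * rho * \sum_(k < K) 1 / 4 * (a k / eta_ L rho k.+1).
  rewrite !mulr_sumr -big_split; apply: ler_sum => k _ /=; apply: lerD.
    rewrite mulrAC ler_wpM2l ?mulr_ge0 // (le_trans (momentum_sqr k.+1)) //.
    by rewrite lef_pV2 ?posrE ?ltr0n // ler_nat.
  have eta0 := step_eta_gt0 L0 rho1 k.+1.
  have -> : 8 * L * rho * (1 / 4 * (a k / eta_ L rho k.+1))
    = (2 * L * rho / eta_ L rho k.+1) * a k by field; rewrite gt_eqF.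
  rewrite ler_wpM2r // ler_pdivlMr //.
  have al1 := @momentum_le1 R k.+1.
  rewrite (momentum_step L0 rho1) in al1.
  have h1 : L * eta_ L rho k.+1 <= 1 / 8.
    have : L * eta_ L rho k.+1 <= rho * (L * eta_ L rho k.+1).
      by rewrite ler_peMl ?(ltW rho1) // mulr_ge0 // ltW.
    lra.
  have h2 := ler_wpM2r (ltW eta0) LfL.
  have h3 := ler_wpM2l (ltW L0) h1.
  have h4 : L <= L * rho by rewrite ler_peMr // ltW.
  lra.
have sK := s0 K.
rewrite big_split /=.
have hfin : \sum_(k < K) eta_ L rho k.+1 * s k <= V / (4 * L * rho)
   + V / (4 * L * rho) * (\sum_(k < K) k.+1%:R^-1)
   + \sum_(k < K) 1 / 4 * (a k / eta_ L rho k.+1).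
  rewrite -(ler_pM2l Lrho) -e1.
  have -> : 8 * L * rho * (V / (4 * L * rho) + V / (4 * L * rho) * (\sum_(k < K) k.+1%:R^-1)
     + \sum_(k < K) 1 / 4 * (a k / eta_ L rho k.+1)) = 2 * V + 2 * V * (\sum_(k < K) k.+1%:R^-1)
     + 8 * L * rho * (\sum_(k < K) 1 / 4 * (a k / eta_ L rho k.+1)).
    move: (\sum_(k < K) _) (\sum_(k < K) _) => p q.
    by field; rewrite !gt_eqF.
  lra.
move: hsum hfin; rewrite -!mulr_sumr mulrDl; lra.
Qed.

Lemma residual_weight (L rho : R) k : 0 < L -> 1 < rho ->
  eta_ L rho k.+1 / (k.+1%:R `^ (1 / 4)) ^+ 2 <= (9 * L * rho)^-1 * k.+1%:R^-1.
Proof.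
move=> L0 rho1; rewrite quarter_powR_sqr /eta_.
have rho0 : 0 < rho := lt_trans ltr01 rho1.
have t0 : 0 < k.+1%:R `^ (1 / 2) :> R by rewrite powR_gt0 // ltr0n.
have t2 := natr_powR_sqr (R := R) k.+1.
have ht : k.+1%:R `^ (1 / 2) <= k.+2%:R `^ (1 / 2) :> R.
  by rewrite ge0_ler_powR ?nnegrE ?ler_nat.
move: (_ `^ _) (k.+2%:R `^ (1 / 2)) t0 t2 ht => t t' t0 <- tt'.
have t'0 := lt_le_trans t0 tt'.
have -> : 1 / (9 * L * rho * t') / t = (9 * L * rho)^-1 * (t' * t)^-1.
  by field; rewrite !gt_eqF.
apply: ler_wpM2l.
  by rewrite invr_ge0 !mulr_ge0 // ltW.
by rewrite lef_pV2 ?posrE ?mulr_gt0 ?exprn_gt0 // expr2 ler_pM2r.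
Qed.

Lemma step_eta_ge (L rho : R) k K : 0 < L -> 1 < rho -> (k < K)%N ->
  1 <= 18 * L * rho * K%:R `^ (1 / 2) * eta_ L rho k.+1.
Proof.
move=> L0 rho1 kK; rewrite /eta_.
have rho0 : 0 < rho := lt_trans ltr01 rho1.
have t0 : 0 < k.+2%:R `^ (1 / 2) :> R by rewrite powR_gt0 // ltr0n.
have ht : k.+2%:R `^ (1 / 2) <= 2 * K%:R `^ (1 / 2) :> R.
  have K0 : 0 <= 2 * K%:R `^ (1 / 2) :> R by rewrite mulr_ge0 ?powR_ge0.
  rewrite -(ler_sqr (ltW t0) K0) exprMn !natr_powR_sqr.
  by rewrite -natrX -natrM ler_nat; lia.
move: (k.+2%:R `^ _) t0 ht => t t0 ht.
have -> : 18 * L * rho * K%:R `^ (1 / 2) * (1 / (9 * L * rho * t))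
  = 2 * K%:R `^ (1 / 2) / t by field; rewrite !gt_eqF.
by rewrite ler_pdivlMr // [leLHS]mul1r.
Qed.

End potential.

(** * Number of iterations and the random index *)

Section iteration_count.
Context {R : realType}.

Lemma ln_le_id (x : R) : 0 < x -> ln x <= x.
Proof.
move=> x0; have := @le_ln1Dx R (x - 1); rewrite [1 + _]addrC subrK => h.
have /h : -1 < x - 1 by lra.
lra.
Qed.

Lemma ln_inv_ge (eps : R) : 0 < eps -> eps <= 1 / 2 -> 1 / 2 <= ln (1 / eps).
Proof.
move=> e0 e1; rewrite [1 / eps]div1r lnV ?posrE //.
have := @le_ln1Dx R (eps - 1); rewrite [1 + _]addrC subrK => h.
have /h : -1 < eps - 1 by lra.
lra.
Qed.

(** With [K] of the order of [eps ^ -4 * ln (1 / eps) ^ 2] one has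
    [1 + ln K = O (ln (1 / eps))], and [sqrt K] beats it by a factor of the
    order of [eps ^ -2]; the free constant [B] is raised to the fourth power so
    that it outgrows the linear contribution [4 * B] of [ln (B ^ 4)]. *)
Lemma iteration_count (C tau : R) : 0 < C -> 0 < tau ->
  exists2 D : R, 0 < D & forall eps : R, 0 < eps <= 1 / 2 ->
  exists K : nat, [/\ (1 <= K)%N,
    K%:R <= D * eps ^- 4 * ln (1 / eps) `^ 2 &
    C * K%:R `^ (1 / 2) * (1 + ln K%:R) <= (tau * eps) ^+ 2 * K%:R].
Proof.
move=> C0 tau0; pose B : R := 1 + 18 * C / tau ^+ 2.
have t2 : 0 < tau ^+ 2 by rewrite exprn_gt0.
have hB : 18 * C <= tau ^+ 2 * B.
  by rewrite /B mulrDr mulr1 mulrCA divff ?gt_eqF // mulr1 lerDr ltW.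
have B1 : 1 <= B by rewrite lerDl divr_ge0 ?ltW // mulr_gt0.
have B0 : 0 < B := lt_le_trans ltr01 B1.
exists (2 * B ^+ 4); first by rewrite mulr_gt0 // exprn_gt0.
move=> eps /andP[e0 e1]; set l := ln (1 / eps).
have l2 : 1 / 2 <= l by exact: ln_inv_ge.
have l0 : 0 < l by lra.
pose y := B ^+ 2 * eps ^- 2 * l.
have i0 : 0 < eps ^- 2 by rewrite invr_gt0 exprn_gt0.
have i4 : 4 <= eps ^- 2.
  rewrite -[4]invrK lef_pV2 ?posrE ?invr_gt0 ?exprn_gt0 //; nra.
have y0 : 0 < y by rewrite !mulr_gt0 // exprn_gt0.
have y1 : 1 <= y.
  have h1 : 1 <= B ^+ 2 by rewrite exprn_ege1.
  have h2 : 2 <= eps ^- 2 * l by nra.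
  rewrite /y -mulrA; nra.
have yE : y ^+ 2 = B ^+ 4 * eps ^- 4 * l ^+ 2.
  by rewrite /y; field; rewrite gt_eqF.
exists (Num.truncn (y ^+ 2)).+1.
have yK : y ^+ 2 <= (Num.truncn (y ^+ 2)).+1%:R by rewrite ltW // truncnS_gt.
have Ky : (Num.truncn (y ^+ 2)).+1%:R <= 2 * y ^+ 2.
  have : (Num.truncn (y ^+ 2))%:R <= y ^+ 2 by rewrite truncn_le sqr_ge0.
  by rewrite -natr1; nra.
move: (Num.truncn (y ^+ 2)).+1 yK Ky (ltn0Sn (Num.truncn (y ^+ 2))) => K yK Ky K0.
have K0' : 0 < K%:R :> R by rewrite ltr0n.
split => //.
  by rewrite powR_mulrn ?(ltW l0) //; move: Ky; rewrite yE !mulrA.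
have lnK : ln (K%:R : R) <= 1 + 4 * B + 6 * l.
  have : ln (K%:R : R) <= ln (2 * y ^+ 2) by rewrite ler_ln ?posrE // mulr_gt0 // exprn_gt0.
  have ei0 : 0 < eps^-1 by rewrite invr_gt0.
  have ly : ln y = 2 * ln B + 2 * ln eps^-1 + ln l.
    have B2 : 0 < B ^+ 2 by rewrite exprn_gt0.
    rewrite /y (lnM (x := B ^+ 2 * eps ^- 2)) ?posrE ?mulr_gt0 //.
    rewrite (lnM (x := B ^+ 2)) ?posrE // -exprVn !lnXn //.
    by rewrite !mulr2n; lra.
  rewrite (lnM (x := 2)) ?posrE ?exprn_gt0 //.
  rewrite lnXn // -[ln y *+ 2]mulr_natl ly.
  have := ln_le_id B0; have := ln_le_id l0.
  have : ln 2 <= 2 - 1 :> R.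
    by have := @le_ln1Dx R (2 - 1); rewrite [1 + _]addrC subrK; apply; lra.
  have le : ln eps^-1 = l by rewrite /l div1r.
  rewrite le; lra.
have h18 : 1 + ln (K%:R : R) <= 18 * B * l.
  have h1 : B <= 2 * (B * l) by rewrite mulrCA ler_peMr ?(ltW B0) //; lra.
  have h2 := ler_peMl (ltW l0) B1.
  lra.
move: (1 + ln _) h18 => lK h18.
have T2 := natr_powR_sqr (R := R) K.
have T0 : 0 <= (K%:R : R) `^ (1 / 2) by exact: powR_ge0.
move: (_ `^ _) T2 T0 => T T2 T0.
have yT : y <= T by rewrite -ler_sqr ?nnegrE ?(ltW y0) // T2.
have e2 : 0 < eps ^+ 2 by rewrite exprn_gt0.
have hy : B ^+ 2 * l <= eps ^+ 2 * T.
  have -> : B ^+ 2 * l = eps ^+ 2 * y by rewrite /y; field; rewrite gt_eqF.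
  by rewrite ler_pM2l.
have h1 := ler_wpM2l (mulr_ge0 (ltW C0) T0) h18.
have h2 := ler_wpM2r (mulr_ge0 (mulr_ge0 (ltW B0) (ltW l0)) T0) hB.
have h3 := ler_wpM2l (mulr_ge0 (ltW t2) T0) hy.
rewrite -T2 exprMn; lra.
Qed.

End iteration_count.

Lemma measurable_select (R : realType) dO (Omega : measurableType dO)
    (khat : Omega -> nat) (F : nat -> Omega -> R) :
  measurable_fun setT khat ->
  (forall k, measurable_fun setT (F k)) ->
  measurable_fun setT (fun w => F (khat w) w).
Proof.
move=> khat_meas mF _ B mB; rewrite setTI.
have -> : (fun w => F (khat w) w) @^-1` B
    = \bigcup_k (khat @^-1` [set k] `&` F k @^-1` B).
  apply/seteqP; split => [w /= Bw|w [k _ [/= <-]] //].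
  by exists (khat w).
apply: bigcupT_measurable => k; apply: measurableI.
  by rewrite -[X in measurable X]setTI; exact: khat_meas.
by rewrite -[X in measurable X]setTI; exact: mF.
Qed.

Section random_index.
Context {R : realType} {dO dX : measure_display}.
Context {Omega : measurableType dO} {Xi : measurableType dX}.
Variables (P : probability Omega R) (mu : probability Xi R).
Variable xi : nat -> Omega -> Xi.
Hypothesis xi_iid : iid_samples P mu xi.
Variables (K : nat) (khat : Omega -> nat).
Hypothesis K_gt0 : (1 <= K)%N.
Hypothesis khat_unif : uniform_index P xi K khat.

Let khat_meas : measurable_fun setT khat. Proof. by have [] := khat_unif. Qed.

Lemma measurable_index_eq k :
  measurable_fun setT (fun w => (khat w == k)%:R : R).
Proof.
have m : measurable_fun setT (fun n : nat => (n == k)%:R : R) by [].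
exact: (measurableT_comp m khat_meas).
Qed.

Lemma index_range : \forall w \ae P, (1 <= khat w <= K)%N.
Proof.
have [_ unif _] := khat_unif.
pose A (k : nat) := khat @^-1` [set k.+1].
have mA k : measurable (A k).
  by rewrite /A -[X in measurable X]setTI; exact: khat_meas.
pose U := \big[setU/set0]_(k < K) A k.
have mU : measurable U by exact: bigsetU_measurable.
have PU : P U = 1%E.
  rewrite /U measure_bigsetU //; last first.
    apply/trivIsetP => i j _ _ ij; apply/seteqP; split => w // -[].
    by rewrite /A /= => -> [/eqP]; rewrite (negbTE ij).
  rewrite (eq_bigr (fun=> (K%:R^-1)%:E)) => [|i _]; last first.
    by apply: unif; rewrite ltn_ord.
  by rewrite sumEFin sumr_const card_ord -[_ *+ K]mulr_natl divff // pnatr_eq0 -lt0n.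
exists (~` U); split; first exact: measurableC.
  by rewrite probability_setC // PU subee.
move=> w /= hw Uw; apply: hw.
move: Uw; rewrite /U -bigcup_mkord => -[k /= kK].
by rewrite /A /= => ->.
Qed.

Lemma index_integral (W : Omega -> R) n k : (1 <= k <= K)%N ->
  measurable_fun (setT : set (past xi n)) W -> (forall w, 0 <= W w) ->
  (\int[P]_w (W w * (khat w == k)%:R)%:E = (K%:R^-1)%:E * \int[P]_w (W w)%:E)%E.
Proof.
move=> kK mW W0; have [_ unif ind] := khat_unif.
have mW' := measurable_past_fun xi_iid mW.
pose khat' : {mfun Omega >-> nat} := HB.pack khat (isMeasurableFun.Build _ _ _ _ khat khat_meas).
have m1 : measurable_fun setT (fun n : nat => (n == k)%:R : R) by [].
have indm : measurable_fun setT (fun n : nat => ((n == k)%:R : R)%:E) by [].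
have ind0 (j : nat) : setT j -> (0 <= ((j == k)%:R : R)%:E)%E.
  by rewrite lee_fin.
have mass : (\int[distribution P khat']_n ((n == k)%:R)%:E = (K%:R^-1)%:E)%E.
  rewrite -(unif _ kK).
  transitivity (\int[distribution P khat']_n (\1_[set k] n)%:E)%E.
    apply: eq_integral => j _; rewrite indicE; congr ((nat_of_bool _)%:R%:E).
    by apply/eqP/idP; rewrite inE.
  by rewrite integral_indic // setIT.
transitivity (\int[P]_w (`|W w| * (khat w == k)%:R)%:E)%E.
  by apply: eq_integral => w _; rewrite ger0_norm.
rewrite (@integral_indep R _ Omega P _ _ _ _ (distribution P khat') W khat
  (fun p => (`|p.1| * (p.2 == k)%:R)%:E)) //.
- transitivity (\int[P]_w ((K%:R^-1)%:E * (W w)%:E))%E.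
    apply: eq_integral => w _ /=; rewrite ger0_norm //.
    under eq_integral do rewrite EFinM.
    rewrite (ge0_integralZl_EFin _ measurableT ind0 indm (W0 w)).
    by rewrite mass muleC.
  have mWE : measurable_fun setT (EFin \o W) by exact/measurable_EFinP.
  rewrite (ge0_integralZl_EFin _ measurableT _ mWE) ?invr_ge0 //.
  by move=> w _; rewrite lee_fin.
- move=> A B mA mB; rewrite muleC.
  rewrite [LHS](_ : _ = P (khat @^-1` B `&` W @^-1` A)); last by rewrite setIC.
  apply: ind; first by exists B => //; rewrite setTI.
  apply: (@past_samples _ _ _ _ _ n); rewrite -[X in measurable X]setTI.
  exact: mW.
- apply/measurable_EFinP; apply: measurable_funM.
    by apply: measurableT_comp => //; exact: measurable_fst.
  exact: (measurableT_comp m1 measurable_snd).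
Qed.

(** The index is independent of the run and uniform, so the mean of a quantity
    read off at the random index is at most the average of the means. *)
Lemma index_mean (W : nat -> Omega -> R) (q : nat -> R) (F : Omega -> \bar R) :
  (forall k, measurable_fun (setT : set (past xi k.+1)) (W k)) ->
  (forall k w, 0 <= W k w) ->
  (forall k, has_mean P (W k) (q k)) ->
  (forall w, (0 <= F w)%E) ->
  (\forall w \ae P, forall k, khat w = k.+1 -> (F w <= (W k w)%:E)%E) ->
  (\int[P]_w F w <= (K%:R^-1 * \sum_(k < K) q k)%:E)%E.
Proof.
move=> mW W0 hW F0 FW.
pose g w := (\sum_(k < K) (W k w * (khat w == k.+1)%:R)%:E)%E.
have mg (k : 'I_K) : measurable_fun setT (fun w => (W k w * (khat w == k.+1)%:R)%:E).
  apply/measurable_EFinP; apply: measurable_funM; last exact: measurable_index_eq.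
  exact: (measurable_past_fun xi_iid (mW k)).
have t0 (k : 'I_K) w : (0 <= (W k w * (khat w == k.+1)%:R)%:E)%E.
  by rewrite lee_fin mulr_ge0.
apply: (@le_trans _ _ (\int[P]_w g w)%E).
  apply: le_integral_majorant => //.
  - by move=> w; apply: sume_ge0.
  - exact: emeasurable_sum.
  - apply: filterS2 FW index_range => w FW /andP[k1 kK].
    case E : (khat w) k1 kK => [//|k] _ kK; apply: (le_trans (FW _ E)).
    rewrite /g (bigD1 (Ordinal kK)) //= E eqxx mulr1 leeDl //.
    by apply: sume_ge0 => i _; rewrite -E.
rewrite ge0_integral_sum //.
rewrite (eq_bigr (fun k : 'I_K => (K%:R^-1 * q k)%:E)) => [|k _].
  by rewrite sumEFin mulr_sumr.
rewrite (index_integral _ (mW k)) //; last by rewrite /= ltn_ord.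
by have [_ ->] := hW k.
Qed.

End random_index.

(** * The stochastic run *)

Section moments.
Context {R : realType} {dX : measure_display} {Xi : measurableType dX}.
Variable mu : probability Xi R.

Lemma has_mean_unique (f : Xi -> R) a b : has_mean mu f a -> has_mean mu f b -> a = b.
Proof. by move=> [_ fa] [_ fb]; apply: EFin_inj; rewrite -fa -fb. Qed.

Lemma has_mean_ge0 (f : Xi -> R) a :
  (forall s, 0 <= f s) -> has_mean mu f a -> 0 <= a.
Proof. by move=> f0; apply: has_mean_le (has_mean_cst mu 0) => s. Qed.

End moments.

Lemma measurable_continuous_coords (R : realType) d0 (T : measurableType d0) n p
    (Phi : 'rV[R]_n -> 'rV[R]_p) (F : T -> 'rV[R]_n) :
  continuous Phi -> (forall i, measurable_fun setT (fun w => F w 0 i)) ->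
  forall i, measurable_fun setT (fun w => Phi (F w) 0 i).
Proof.
move=> cPhi mF i; apply: (@measurable_rV_coord R d0 T p (Phi \o F)).
exact: (measurableT_comp (continuous_measurable_rV cPhi) (measurable_rV mF)).
Qed.

Section stochastic_run.
Context {R : realType} {d m : nat}.
Variables (X : set 'rV[R]_d) (f : 'rV[R]_d -> R) (c : 'rV[R]_d -> 'rV[R]_m).
Hypothesis X_closed : closed X.
Hypothesis X_convex : convex_set (X : set (convex_lmodType 'rV[R]_d)).
Hypothesis c_diff : forall x, differentiable c x.
Context {dX : measure_display} {Xi : measurableType dX}.
Variables (mu : probability Xi R) (G : 'rV[R]_d -> Xi -> 'rV[R]_d).
Hypothesis G_meas : forall j : 'I_d, measurable_fun setT
  (fun z : borel_rV R d * Xi => G z.1 z.2 0 j).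
Hypothesis G_unbiased : forall x (j : 'I_d),
  ('E_mu[fun s => G x s 0%R j] = (grad f x 0%R j)%:E)%E.
Variables (Lf Lgc Lc sigmaf Cgc Cc Cgf rho : R).
Hypotheses (Lf_gt0 : 0 < Lf) (Lgc_gt0 : 0 < Lgc) (Lc_gt0 : 0 < Lc).
Hypotheses (Cgc_gt0 : 0 < Cgc) (Cc_gt0 : 0 < Cc).
Hypothesis rho_gt1 : 1 < rho.
Hypothesis G_lip : forall x y,
  ('E_mu[fun s => (enorm (G x s - G y s) ^+ 2)%R]
     <= (Lf ^+ 2 * enorm (x - y)%R ^+ 2)%:E)%E.
Hypothesis gc_lip :
  forall x y, opnorm (jac c x - jac c y) <= Lgc * enorm (x - y).
Hypothesis c_lip : forall x y, enorm (c x - c y) <= Lc * enorm (x - y).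
Hypothesis G_var : forall x,
  ('E_mu[fun s => (enorm (G x s - grad f x) ^+ 2)%R] <= (sigmaf ^+ 2)%:E)%E.
Hypothesis gc_bound : forall x, opnorm (jac c x) <= Cgc.
Hypothesis c_bound : forall x, enorm (c x) <= Cc.
Hypothesis gf_bound : forall x, enorm (grad f x) <= Cgf.
Context {dO : measure_display} {Omega : measurableType dO}.
Variables (P : probability Omega R) (xi : nat -> Omega -> Xi).
Hypothesis xi_iid : iid_samples P mu xi.
Variables (x1 : 'rV[R]_d) (x g : nat -> Omega -> 'rV[R]_d).
Hypothesis x1_in : X x1.
Local Notation L := (Ltilde m Lf Lgc Lc Cgc Cc).
Hypothesis run : forall w, slqp_run X G c (eta_ L rho)
  (rho_ rho) alpha_ x1 (xi ^~ w) (x ^~ w) (g ^~ w).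

Let h y := c y *m jac c y.

(** The constraint gradients are exact, so they cancel from the estimator:
    removing the penalty part of [g k] leaves a momentum estimator of
    [grad f]. *)
Let v k w := g k w - rho_ rho k *: h (x k w).
Definition grad_error k w := g k w - grad_penalty f c (rho_ rho k) (x k w).

Let errorE k w : grad_error k w = v k w - grad f (x k w).
Proof. by rewrite /grad_error /v /grad_penalty opprD addrCA addrC. Qed.

Let sgradE r y s : sgrad_penalty G c r y s = G y s + r *: h y.
Proof. by rewrite /sgrad_penalty sum_grad_jac. Qed.

Let v1 w : v 1 w = G x1 (xi 1 w).
Proof. by rewrite /v (run_g1 (run w)) (run_x1 (run w)) sgradE addrK. Qed.

Let v_next k w : v k.+2 w = G (x k.+2 w) (xi k.+2 w)
  + (1 - alpha_ k.+2) *: (v k.+1 w - G (x k.+1 w) (xi k.+2 w)).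
Proof.
rewrite /v (run_g (run w)) // !sgradE addrAC addrK; congr (_ + _ *: _).
by rewrite opprD addrA addrAC.
Qed.

Let error1 w : grad_error 1 w = G x1 (xi 1 w) - grad f x1.
Proof. by rewrite errorE v1 (run_x1 (run w)). Qed.

Let error_next k w (a := alpha_ k.+2) (s := xi k.+2 w) (y := x k.+2 w)
    (z := x k.+1 w) :
  grad_error k.+2 w = (1 - a) *: grad_error k.+1 w
    + (a *: (G y s - grad f y)
       + (1 - a) *: ((G y s - G z s) - (grad f y - grad f z))).
Proof.
rewrite !errorE v_next -/a -/s -/y -/z.
by apply/rowP => j; rewrite !mxE; ring.
Qed.

Let gf_lip := mean_lipschitz (ltW Lf_gt0) G_meas G_unbiased G_lip G_var.

Lemma continuous_grad : continuous (grad f).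
Proof. exact: lipschitz_continuous gf_lip. Qed.

Lemma continuous_constraint : continuous c.
Proof. exact: lipschitz_continuous c_lip. Qed.

Lemma continuous_constraint_grad : continuous h.
Proof.
exact: (lipschitz_continuous
  (constraint_grad_lip Lgc_gt0 Cgc_gt0 gc_lip c_lip gc_bound c_bound)).
Qed.

Let X_nonempty : X !=set0. Proof. by exists x1. Qed.

Lemma continuous_proj : continuous (Defs.proj X).
Proof.
apply: (@lipschitz_continuous _ _ _ _ 1) => y z; rewrite mul1r.
exact: proj_nonexpansive.
Qed.

Let oracle_comp d0 (T : measurableType d0) (F : T -> 'rV[R]_d) (zeta : T -> Xi) :
  (forall i, measurable_fun setT (fun t => F t 0 i)) ->
  measurable_fun setT zeta ->
  forall j, measurable_fun setT (fun t => G (F t) (zeta t) 0 j).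
Proof.
move=> mF mz j.
exact: (measurableT_comp (G_meas j) (measurable_fun_pair (measurable_rV mF) mz)).
Qed.

(** The iterate depends on one sample fewer than the estimator; this is why the
    sample drawn next is fresh for both arguments of the oracle. *)
Lemma run_measurable k :
  (forall i, measurable_fun (setT : set (past xi k)) (fun w => x k.+1 w 0 i)) /\
  (forall i, measurable_fun (setT : set (past xi k.+1)) (fun w => v k.+1 w 0 i)).
Proof.
elim: k => [|k [mx mv]].
  split=> i.
    under eq_fun do rewrite (run_x1 (run _)).
    exact: measurable_cst.
  under eq_fun do rewrite v1.
  apply: (@oracle_comp _ (past xi 1) (fun=> x1)) => [j|].
    exact: measurable_cst.
  exact: measurable_past_sample.
have mx' i : measurable_fun (setT : set (past xi k.+1)) (fun w => x k.+1 w 0 i).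
  exact: measurable_past_leq (mx i).
have mx2 i : measurable_fun (setT : set (past xi k.+1)) (fun w => x k.+2 w 0 i).
  under eq_fun do rewrite (run_x (run _)) //.
  apply: (measurable_continuous_coords continuous_proj).
  apply: measurable_subrV => //; apply: measurable_scalerV.
  have -> : g k.+1 = (fun w => v k.+1 w + rho_ rho k.+1 *: h (x k.+1 w)).
    by apply/funext => w; rewrite /v subrK.
  apply: measurable_addrV => //; apply: measurable_scalerV.
  exact: (measurable_continuous_coords continuous_constraint_grad mx').
split; first exact: mx2.
move=> i; under eq_fun do rewrite v_next.
have mx2' j : measurable_fun (setT : set (past xi k.+2)) (fun w => x k.+2 w 0 j).
  exact: measurable_past_leq (mx2 j).
have mx1' j : measurable_fun (setT : set (past xi k.+2)) (fun w => x k.+1 w 0 j).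
  exact: measurable_past_leq (mx' j).
have mv1' j : measurable_fun (setT : set (past xi k.+2)) (fun w => v k.+1 w 0 j).
  exact: measurable_past_leq (mv j).
have mxi : measurable_fun (setT : set (past xi k.+2)) (xi k.+2).
  exact: measurable_past_sample.
apply: measurable_addrV; first exact: oracle_comp.
apply: measurable_scalerV; apply: measurable_subrV; first exact: mv1'.
exact: oracle_comp.
Qed.

Lemma error_measurable k i :
  measurable_fun (setT : set (past xi k.+1)) (fun w => grad_error k.+1 w 0 i).
Proof.
have [mx mv] := run_measurable k.
have mx' j : measurable_fun (setT : set (past xi k.+1)) (fun w => x k.+1 w 0 j).
  exact: measurable_past_leq (mx j).
under eq_fun do rewrite errorE; apply: measurable_subrV => //.
exact: (measurable_continuous_coords continuous_grad mx').
Qed.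

(** The sample [xi k.+1] is independent of everything that is measurable with
    respect to the first [k] samples, so the bound of [oracle_step], which
    holds for fixed points, can be integrated over the past. *)
Lemma fresh_step k (a y z : Omega -> 'rV[R]_d) (al : R) : 0 <= al -> al <= 1 ->
  (forall i, measurable_fun (setT : set (past xi k)) (fun w => a w 0 i)) ->
  (forall i, measurable_fun (setT : set (past xi k)) (fun w => y w 0 i)) ->
  (forall i, measurable_fun (setT : set (past xi k)) (fun w => z w 0 i)) ->
  (\int[P]_w (enorm (a w + (al *: (G (y w) (xi k.+1 w) - grad f (y w))
     + (1 - al) *: ((G (y w) (xi k.+1 w) - G (z w) (xi k.+1 w))
                    - (grad f (y w) - grad f (z w))))) ^+ 2)%:E
  <= \int[P]_w (enorm (a w) ^+ 2 + 2 * al ^+ 2 * sigmaf ^+ 2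
       + 2 * Lf ^+ 2 * enorm (y w - z w) ^+ 2)%:E)%E.
Proof.
move=> al0 al1 ma my mz.
pose N (w : Omega) (s : Xi) := a w + (al *: (G (y w) s - grad f (y w))
     + (1 - al) *: ((G (y w) s - G (z w) s) - (grad f (y w) - grad f (z w)))).
have mN : forall i, measurable_fun setT (fun p : past xi k * Xi => N p.1 p.2 0 i).
  have fstm (F : Omega -> 'rV[R]_d) :
    (forall i, measurable_fun (setT : set (past xi k)) (fun w => F w 0 i)) ->
    forall i, measurable_fun setT (fun p : past xi k * Xi => F p.1 0 i).
    by move=> mF i; exact: (measurableT_comp (mF i) measurable_fst).
  have mgy := measurable_continuous_coords continuous_grad my.
  have mgz := measurable_continuous_coords continuous_grad mz.
  have mGy := oracle_comp (fstm _ my) measurable_snd.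
  have mGz := oracle_comp (fstm _ mz) measurable_snd.
  apply: measurable_addrV; first exact: fstm.
  apply: measurable_addrV; apply: measurable_scalerV.
    by apply: measurable_subrV => //; exact: (fstm (fun w => grad f (y w))).
  apply: measurable_subrV; first exact: measurable_subrV.
  by apply: measurable_subrV; [exact: (fstm (fun w => grad f (y w)))
                              |exact: (fstm (fun w => grad f (z w)))].
have mid : measurable_fun setT (id : Omega -> past xi k).
  by move=> _ A mA; rewrite setTI; exact: (past_sub xi_iid mA).
have [mxi _ _] := xi_iid.
rewrite [leLHS](@integral_indep R _ Omega P _ _ (past xi k) Xi mu id (xi k.+1)
  (fun p => (enorm (N p.1 p.2) ^+ 2)%:E)) //; first last.
- by move=> p; rewrite lee_fin sqr_ge0.
- by apply/measurable_EFinP; apply: measurable_funX; exact: measurable_enorm.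
- by move=> A B mA mB; rewrite (past_indep xi_iid mA mB).
- exact: mxi.
apply: le_integral_majorant.
- by move=> w; apply: integral_ge0 => s _; rewrite lee_fin sqr_ge0.
- move=> w; rewrite lee_fin.
  have h1 := mulr_ge0 (sqr_ge0 al) (sqr_ge0 sigmaf).
  have h2 := mulr_ge0 (sqr_ge0 Lf) (sqr_ge0 (enorm (y w - z w))).
  have h3 := sqr_ge0 (enorm (a w)); lra.
- apply/measurable_EFinP; apply: (measurable_past_fun xi_iid (k := k)).
  have me : measurable_fun (setT : set (past xi k)) (fun w => enorm (a w)).
    exact: measurable_enorm.
  have md : measurable_fun (setT : set (past xi k)) (fun w => enorm (y w - z w)).
    by apply: measurable_enorm; exact: measurable_subrV.
  apply: measurable_funD; first by apply: measurable_funD => //; exact: measurable_funX.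
  by apply: measurable_funM => //; exact: measurable_funX.
- apply: aeW => w; exact: (oracle_step G_meas G_unbiased G_lip G_var
    (a w) (z w) (y w) al0 al1).
Qed.

Lemma run_next w k : (1 <= k)%N -> x k.+1 w = Defs.proj X
  (x k w - eta_ L rho k *:
    (grad_penalty f c (rho_ rho k) (x k w) + grad_error k w)).
Proof.
move=> k1; rewrite (run_x (run w) k1); congr (Defs.proj X (_ - _ *: _)).
by rewrite /grad_error addrC subrK.
Qed.

Let x1_in_w w : X (x 1 w). Proof. by rewrite (run_x1 (run w)). Qed.

Lemma increment_measurable k i :
  measurable_fun (setT : set (past xi k.+1)) (fun w => (x k.+2 w - x k.+1 w) 0 i).
Proof.
have [mx _] := run_measurable k; have [mx' _] := run_measurable k.+1.
by apply: measurable_subrV => // j; exact: measurable_past_leq (mx j).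
Qed.

Let measurable_sqr_enorm k (F : Omega -> 'rV[R]_d) :
  (forall i, measurable_fun (setT : set (past xi k)) (fun w => F w 0 i)) ->
  measurable_fun setT (fun w => enorm (F w) ^+ 2).
Proof.
move=> mF; apply: (measurable_past_fun xi_iid (k := k)).
by apply: measurable_funX; exact: measurable_enorm.
Qed.

(** The projection is nonexpansive, so an increment is at most the step size
    times the direction, whose exact part is bounded. *)
Lemma increment_moment k s :
  has_mean P (fun w => enorm (grad_error k.+1 w) ^+ 2) s ->
  exists a, has_mean P (fun w => enorm (x k.+2 w - x k.+1 w) ^+ 2) a.
Proof.
move=> hs; set M := Cgf + rho_ rho k.+1 * (Cgc * Cc).
have r1 := penalty_weight_ge1 rho_gt1 (ltn0Sn k).
have r0 : 0 <= rho_ rho k.+1 := le_trans ler01 r1.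
have hM y : enorm (grad_penalty f c (rho_ rho k.+1) y) <= M.
  rewrite /grad_penalty (le_trans (enormD _ _)) // lerD // enormZ ger0_norm //.
  rewrite ler_wpM2l // (le_trans (opnorm_mul _ _)) //.
  apply: (le_trans (ler_wpM2r (enorm_ge0 _) (gc_bound y))).
  by rewrite ler_wpM2l // ltW.
have hb := has_meanZ (2 * eta_ L rho k.+1 ^+ 2) (has_meanD (has_mean_cst P (M ^+ 2)) hs).
apply: has_mean_dominated hb => [|w].
  exact: (measurable_sqr_enorm (@increment_measurable k)).
rewrite ger0_norm ?sqr_ge0 //.
have Lg : 0 < L by exact: Ltilde_gt0.
have eta0 := step_eta_gt0 Lg rho_gt1 k.+1.
have hstep := @run_step_bound _ _ _ X f c X_closed X_convex _ _ _ _ _ Lf_gt0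
  rho rho_gt1 (x ^~ w) (grad_error ^~ w) (x1_in_w w) (run_next w) k.+1 (ltn0Sn k).
apply: (le_trans (y := (eta_ L rho k.+1 * enorm (grad_penalty f c (rho_ rho k.+1) (x k.+1 w)
   + grad_error k.+1 w)) ^+ 2)).
  by rewrite ler_sqr // nnegrE ?enorm_ge0 // mulr_ge0 ?enorm_ge0 // ltW.
have hM2 : enorm (grad_penalty f c (rho_ rho k.+1) (x k.+1 w)) ^+ 2 <= M ^+ 2.
  by rewrite ler_sqr ?nnegrE ?enorm_ge0 // (le_trans _ (hM 0)) ?enorm_ge0.
have e2 := sqr_ge0 (eta_ L rho k.+1).
rewrite exprMn (le_trans (ler_wpM2l e2 (enormD_sqr _ _))) //.
have := ler_wpM2l e2 hM2; lra.
Qed.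

Lemma error_moment0 : exists2 s,
  has_mean P (fun w => enorm (grad_error 1 w) ^+ 2) s & s <= 2 * sigmaf ^+ 2.
Proof.
apply: has_mean_bound.
- exact: (measurable_sqr_enorm (@error_measurable 0)).
- by move=> w; exact: sqr_ge0.
have mc (y : 'rV[R]_d) i : measurable_fun (setT : set (past xi 0)) (fun=> y 0 i).
  exact: measurable_cst.
have := fresh_step ler01 (lexx 1) (mc 0) (mc x1) (mc x1).
under eq_integral do rewrite add0r subrr scale0r addr0 scale1r -error1.
move=> /le_trans; apply.
under eq_integral do rewrite subrr enorm0 expr0n /= mulr0 addr0 add0r expr1n mulr1.
by have [_ ->] := has_mean_cst P (2 * sigmaf ^+ 2).
Qed.

Lemma error_moment_next k s a :
  has_mean P (fun w => enorm (grad_error k.+1 w) ^+ 2) s ->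
  has_mean P (fun w => enorm (x k.+2 w - x k.+1 w) ^+ 2) a ->
  exists2 s', has_mean P (fun w => enorm (grad_error k.+2 w) ^+ 2) s' &
    s' <= (1 - alpha_ k.+2) * s + 2 * alpha_ k.+2 ^+ 2 * sigmaf ^+ 2
          + 2 * Lf ^+ 2 * a.
Proof.
move=> hs ha; have Lg : 0 < L by exact: Ltilde_gt0.
have al0 := ltW (momentum_gt0 Lg rho_gt1 k.+1).
have al1 := @momentum_le1 R k.+1.
apply: has_mean_bound.
- exact: (measurable_sqr_enorm (@error_measurable k.+1)).
- by move=> w; exact: sqr_ge0.
have [mx _] := run_measurable k; have [mx' _] := run_measurable k.+1.
have mx1 i := measurable_past_leq (leqnSn k) (mx i).
have me := measurable_scalerV (1 - alpha_ k.+2) (@error_measurable k).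
have := fresh_step al0 al1 me mx' mx1.
under eq_integral do rewrite -error_next.
move=> /le_trans; apply.
have hb := has_meanD (has_meanD (has_meanZ ((1 - alpha_ k.+2) ^+ 2) hs)
  (has_mean_cst P (2 * alpha_ k.+2 ^+ 2 * sigmaf ^+ 2))) (has_meanZ (2 * Lf ^+ 2) ha).
under eq_integral do rewrite enormZ exprMn real_normK ?num_real //.
rewrite hb.2 lee_fin !lerD2r ler_wpM2r //.
  by apply: has_mean_ge0 hs => w; exact: sqr_ge0.
have : 0 <= 1 - alpha_ k.+2 :> R by rewrite subr_ge0.
have : 1 - alpha_ k.+2 <= 1 :> R by rewrite gerBl.
move: (1 - _) => b b1 b0; nra.
Qed.

Lemma moments : exists s a : nat -> R, [/\
  forall k, has_mean P (fun w => enorm (grad_error k.+1 w) ^+ 2) (s k),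
  forall k, has_mean P (fun w => enorm (x k.+2 w - x k.+1 w) ^+ 2) (a k),
  s 0%N <= 2 * sigmaf ^+ 2 &
  forall k, s k.+1 <= (1 - alpha_ k.+2) * s k
    + 2 * alpha_ k.+2 ^+ 2 * sigmaf ^+ 2 + 2 * Lf ^+ 2 * a k].
Proof.
have hs k : exists s, has_mean P (fun w => enorm (grad_error k.+1 w) ^+ 2) s.
  elim: k => [|k [s hs]]; first by have [s hs _] := error_moment0; exists s.
  have [a ha] := increment_moment hs.
  by have [s' hs' _] := error_moment_next hs ha; exists s'.
have [s {}hs] := choice hs.
have [a ha] := choice (fun k => increment_moment (hs k)).
exists s, a; split => //.
  have [s0 hs0 s0le] := error_moment0.
  by rewrite (has_mean_unique (hs 0%N) hs0).
move=> k; have [s' hs' s'le] := error_moment_next (hs k) (ha k).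
by rewrite (has_mean_unique (hs k.+1) hs').
Qed.

Section convergence.
Variables (delta Qlow : R).
Hypothesis f_diff : forall x, differentiable f x.
Hypothesis delta_gt0 : 0 < delta.
Hypothesis Q_bound : forall r x, 0 < r -> Qlow <= penalty f c r x.
Hypothesis c_reg : \forall w \ae P, forall k, (1 <= k)%N ->
  delta * enorm (c (x k w))
    <= dist (c (x k w) *m jac c (x k w)) (neg_normal_cone X (x k w)).

Definition run_residual k w : R :=
  residual L rho Cgf (x ^~ w) (grad_error ^~ w) k.+1.

Let L_gt0 : 0 < L. Proof. exact: Ltilde_gt0. Qed.
Let rho_gt0 : 0 < rho. Proof. exact: lt_trans rho_gt1. Qed.
Let Cgf_ge0 : 0 <= Cgf.
Proof. exact: le_trans (enorm_ge0 _) (gf_bound 0). Qed.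

Lemma run_residual_ge0 k w : 0 <= run_residual k w.
Proof.
have eta0 := step_eta_gt0 L_gt0 rho_gt1 k.+1.
have h1 := divr_ge0 (enorm_ge0 (x k.+2 w - x k.+1 w)) (ltW eta0).
have h2 := enorm_ge0 (grad_error k.+1 w).
have h3 := divr_ge0 Cgf_ge0 (powR_ge0 k.+1%:R (1 / 4)).
rewrite /run_residual /residual; lra.
Qed.

Lemma run_residual_measurable k :
  measurable_fun (setT : set (past xi k.+1)) (run_residual k).
Proof.
have m1 := measurable_enorm (@increment_measurable k).
have m2 := measurable_enorm (@error_measurable k).
rewrite /run_residual /residual; apply: measurable_funD => //.
apply: measurable_funD => //; apply: measurable_funM => //.
exact: measurable_funM.
Qed.

(** The descent inequality is summed along each trajectory before taking means;
    the penalty function then enters through its initial value and its lower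
    bound only. *)
Lemma descent_in_mean (s a : nat -> R) K :
  (forall k, has_mean P (fun w => enorm (grad_error k.+1 w) ^+ 2) (s k)) ->
  (forall k, has_mean P (fun w => enorm (x k.+2 w - x k.+1 w) ^+ 2) (a k)) ->
  \sum_(k < K) 1 / 3 * (a k / eta_ L rho k.+1)
  <= penalty f c (rho_ rho 1) x1 - Qlow
     + \sum_(k < K) 11 / 20 * (eta_ L rho k.+1 * s k)
     + drift L rho delta Cgf Cc * \sum_(k < K) k.+1%:R^-1.
Proof.
move=> hs ha.
have eta0 k := step_eta_gt0 L_gt0 rho_gt1 k.
have r1 k : 0 < rho_ rho k.+1 := lt_le_trans ltr01 (penalty_weight_ge1 rho_gt1 (ltn0Sn k)).
pose lhs w := \sum_(k < K) 1 / 3 * ((eta_ L rho k.+1)^-1 * enorm (x k.+2 w - x k.+1 w) ^+ 2).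
pose rhs w := penalty f c (rho_ rho 1) x1 - Qlow
  + drift L rho delta Cgf Cc * (\sum_(k < K) k.+1%:R^-1)
  + \sum_(k < K) 11 / 20 * (eta_ L rho k.+1 * enorm (grad_error k.+1 w) ^+ 2).
have hl : has_mean P lhs (\sum_(k < K) 1 / 3 * ((eta_ L rho k.+1)^-1 * a k)).
  by apply: has_mean_sum => k; do 2 apply: has_meanZ; exact: ha.
have hr : has_mean P rhs (penalty f c (rho_ rho 1) x1 - Qlow
  + drift L rho delta Cgf Cc * (\sum_(k < K) k.+1%:R^-1)
  + \sum_(k < K) 11 / 20 * (eta_ L rho k.+1 * s k)).
  apply: has_meanD; first exact: has_mean_cst.
  by apply: has_mean_sum => k; do 2 apply: has_meanZ; exact: hs.
have lhs0 w : 0 <= lhs w.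
  apply: sumr_ge0 => k _; apply: mulr_ge0 => //; apply: mulr_ge0 (sqr_ge0 _).
  by rewrite invr_ge0 ltW.
have H0 : 0 <= \sum_(k < K) k.+1%:R^-1 :> R.
  by apply: sumr_ge0 => k _; rewrite invr_ge0.
have rhs0 w : 0 <= rhs w.
  apply: addr_ge0; first apply: addr_ge0.
  - by rewrite subr_ge0; exact: Q_bound.
  - by apply: mulr_ge0 H0; exact: drift_ge0.
  - apply: sumr_ge0 => k _; apply: mulr_ge0 => //; apply: mulr_ge0 (sqr_ge0 _).
    exact: ltW.
have hle : \forall w \ae P, ((lhs w)%:E <= (rhs w)%:E)%E.
  apply: filterS c_reg => w reg; rewrite lee_fin.
  have := @run_descent _ _ _ X f c X_closed X_convex f_diff c_diff _ _ _ _ _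
    Lf_gt0 Lgc_gt0 Lc_gt0 Cgc_gt0 Cc_gt0 gf_lip gc_lip c_lip gc_bound c_bound
    rho delta Cgf rho_gt1 delta_gt0 gf_bound (x ^~ w) (grad_error ^~ w)
    (x1_in_w w) (run_next w) reg K.
  have := Q_bound (x K.+1 w) (r1 K); rewrite (run_x1 (run w)) /lhs /rhs.
  under [in X in _ -> X -> _]eq_bigr do rewrite [_ / eta_ _ _ _]mulrC.
  lra.
have [_ el] := hl; have [/integrableP[/measurable_EFinP mr _] er] := hr.
under eq_bigr do rewrite [a _ / _]mulrC.
rewrite addrAC -lee_fin -el -er.
by apply: le_integral_majorant hle => [w|w|]; rewrite ?lee_fin //; exact/measurable_EFinP.
Qed.

(** Weighted by the step sizes the mean squares sum to a multiple of the harmonic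
    sum; the smallest of the first [K] weights is of order [K ^ (- 1/2)], which
    costs the factor [sqrt K]. *)
Lemma residual_moments : exists (C : R) (q : nat -> R), [/\ 0 < C,
  forall k, has_mean P (fun w => run_residual k w ^+ 2) (q k) &
  forall K, (1 <= K)%N ->
    \sum_(k < K) q k <= C * K%:R `^ (1 / 2) * (1 + ln K%:R)].
Proof.
have [s [a [hs ha s0 srec]]] := moments.
have eta0 k := step_eta_gt0 L_gt0 rho_gt1 k.
have s_ge0 k : 0 <= s k by apply: has_mean_ge0 (hs k) => w; exact: sqr_ge0.
have a_ge0 k : 0 <= a k by apply: has_mean_ge0 (ha k) => w; exact: sqr_ge0.
have dom k w : run_residual k w ^+ 2 <= 3 * Cgf ^+ 2 / (k.+1%:R `^ (1 / 4)) ^+ 2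
   + (100 / 27 / eta_ L rho k.+1 ^+ 2) * enorm (x k.+2 w - x k.+1 w) ^+ 2
   + 3 * enorm (grad_error k.+1 w) ^+ 2.
  rewrite /run_residual /residual.
  have -> : 100 / 27 / eta_ L rho k.+1 ^+ 2 * enorm (x k.+2 w - x k.+1 w) ^+ 2
    = 3 * (10 / 9 * (enorm (x k.+2 w - x k.+1 w) / eta_ L rho k.+1)) ^+ 2.
    by field; rewrite gt_eqF.
  have -> : 3 * Cgf ^+ 2 / (k.+1%:R `^ (1 / 4)) ^+ 2 = 3 * (Cgf / k.+1%:R `^ (1 / 4)) ^+ 2.
    by field; rewrite gt_eqF // powR_gt0 // ltr0n.
  move: (10 / 9 * _) (enorm (grad_error _ _)) (Cgf / _) => p q r.
  have := sqr_ge0 (p - q); have := sqr_ge0 (p - r); have := sqr_ge0 (q - r); lra.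
have hq k := has_meanD (has_meanD (has_mean_cst P (3 * Cgf ^+ 2 / (k.+1%:R `^ (1 / 4)) ^+ 2))
   (has_meanZ (100 / 27 / eta_ L rho k.+1 ^+ 2) (ha k))) (has_meanZ 3 (hs k)).
have ex k : exists q, has_mean P (fun w => run_residual k w ^+ 2) q.
  apply: has_mean_dominated (hq k) => [|w]; last by rewrite ger0_norm ?sqr_ge0.
  apply: measurable_funX.
  exact: (measurable_past_fun xi_iid (@run_residual_measurable k)).
have [q {}ex] := choice ex.
have qle k : eta_ L rho k.+1 * q k <= Cgf ^+ 2 / (3 * L * rho) * k.+1%:R^-1
    + 45 * (1 / 12 * (a k / eta_ L rho k.+1) + 9 / 20 * (eta_ L rho k.+1 * s k)).
  have h1 := has_mean_le (dom k) (ex k) (hq k).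
  have h2 := ler_wpM2l (ltW (eta0 k.+1)) h1.
  have h3 := ler_wpM2l (mulr_ge0 (ler0n R 3) (sqr_ge0 Cgf)) (residual_weight k L_gt0 rho_gt1).
  have e1 : eta_ L rho k.+1 * (100 / 27 / eta_ L rho k.+1 ^+ 2 * a k)
     = 100 / 27 * (a k / eta_ L rho k.+1) by field; rewrite gt_eqF.
  have e2 : 3 * Cgf ^+ 2 * ((9 * L * rho)^-1 * k.+1%:R^-1) = Cgf ^+ 2 / (3 * L * rho) * k.+1%:R^-1.
    rewrite mulrA; congr (_ * _).
    by field; rewrite !gt_eqF.
  have h4 : 0 <= a k / eta_ L rho k.+1 by rewrite divr_ge0 // ltW.
  have h5 := mulr_ge0 (ltW (eta0 k.+1)) (s_ge0 k).
  have e3 : eta_ L rho k.+1 * (3 * Cgf ^+ 2 / (k.+1%:R `^ (1 / 4)) ^+ 2)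
    = 3 * Cgf ^+ 2 * (eta_ L rho k.+1 / (k.+1%:R `^ (1 / 4)) ^+ 2) by rewrite mulrCA.
  move: h2; rewrite !mulrDr e1 e3 => h2.
  rewrite e2 in h3; move: h2 h3 h4 h5.
  move: (_ / (3 * L * rho) * _) (_ / (_ `^ _) ^+ 2) (a k / _) => p1 p2 p3.
  by move: (eta_ L rho k.+1) => eta; lra.
pose V := sigmaf ^+ 2.
pose A1 := penalty f c (rho_ rho 1) x1 - Qlow + V / (4 * L * rho).
pose A2 := drift L rho delta Cgf Cc + V / (4 * L * rho).
have r1 : 0 < rho_ rho 1 := lt_le_trans ltr01 (penalty_weight_ge1 rho_gt1 (leqnn 1)).
have V0 : 0 <= V / (4 * L * rho) by rewrite divr_ge0 ?sqr_ge0 // !mulr_ge0 // ltW.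
have A10 : 0 <= A1 by rewrite addr_ge0 // subr_ge0 Q_bound.
have A20 : 0 <= A2 by rewrite addr_ge0 //; exact: drift_ge0.
have B0 : 0 <= Cgf ^+ 2 / (3 * L * rho) by rewrite divr_ge0 ?sqr_ge0 // !mulr_ge0 // ltW.
pose A := 1 + Cgf ^+ 2 / (3 * L * rho) + 45 * (A1 + A2).
exists (18 * L * rho * A), q; split => //.
  apply: mulr_gt0; first by rewrite !mulr_gt0.
  rewrite /A; lra.
move=> K K1.
pose H : R := \sum_(k < K) k.+1%:R^-1.
have H1 : 1 <= H.
  rewrite /H; case: (K) K1 => // K' _; rewrite big_ord_recl /= invr1 lerDl.
  by apply: sumr_ge0 => k _; rewrite invr_ge0.
have Hle : H <= 1 + ln K%:R by exact: harmonic_le_ln.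
have hpot := potential_sum L_gt0 rho_gt1 (sqr_ge0 sigmaf) (@four_sqr_Lf_le R m Lf Lgc Lc Cgc Cc)
  s_ge0 a_ge0 s0 srec (descent_in_mean K hs ha).
have hsum : \sum_(k < K) eta_ L rho k.+1 * q k <= A * H.
  apply: (le_trans (ler_sum _ (fun (k : 'I_K) _ => qle k))).
  rewrite big_split /= -!mulr_sumr -/H.
  move: hpot; rewrite -/V -/A1 -/A2 -/H => hpot.
  have : A1 <= A1 * H by rewrite ler_peMr.
  rewrite /A; move: hpot; move: (\sum_(k < K) _) => S; lra.
set T := K%:R `^ (1 / 2).
have T0 : 0 <= 18 * L * rho * T by rewrite !mulr_ge0 ?powR_ge0 // ltW.
have q_ge0 k : 0 <= q k by apply: has_mean_ge0 (ex k) => w; exact: sqr_ge0.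
have A0 : 0 <= A by rewrite /A; lra.
apply: (le_trans (y := 18 * L * rho * T * (A * H))).
  apply: (le_trans _ (ler_wpM2l T0 hsum)); rewrite mulr_sumr; apply: ler_sum => k _.
  by rewrite mulrA ler_peMl // step_eta_ge.
have := ler_wpM2l (mulr_ge0 T0 A0) Hle; lra.
Qed.

Lemma run_residual_stationarity k w :
  dist (grad f (x k.+2 w)
        + (rho_ rho k.+1 *: c (x k.+2 w)) *m jac c (x k.+2 w))
    (neg_normal_cone X (x k.+2 w)) <= run_residual k w.
Proof.
exact: (run_stationarity X_closed X_convex Lf_gt0 Lgc_gt0 Lc_gt0 Cgc_gt0 Cc_gt0
  gf_lip gc_lip c_lip gc_bound c_bound rho_gt1 gf_bound (x1_in_w w)
  (run_next w) (ltn0Sn k)).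
Qed.

Lemma run_residual_feasibility : \forall w \ae P, forall k,
  delta * rho * enorm (c (x k.+2 w)) <= run_residual k w.
Proof.
apply: filterS c_reg => w reg k.
exact: (run_feasibility X_closed X_convex Lf_gt0 Lgc_gt0 Lc_gt0 Cgc_gt0 Cc_gt0
  gf_lip gc_lip c_lip gc_bound c_bound rho_gt1 delta_gt0 gf_bound (x1_in_w w)
  (run_next w) reg (ltn0Sn k)).
Qed.

Lemma multiplier_measurable (khat : Omega -> nat) i :
  measurable_fun setT khat ->
  measurable_fun setT
    (fun w => (rho_ rho (khat w) *: c (x (khat w).+1 w)) 0 i).
Proof.
move=> mk.
suff mF k : measurable_fun setT (fun w => (rho_ rho k *: c (x k.+1 w)) 0 i).
  exact: (measurable_select mk mF).
apply: (measurable_past_fun xi_iid (k := k)); move: i.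
have [mx _] := run_measurable k; apply: measurable_scalerV.
exact: (measurable_continuous_coords continuous_constraint mx).
Qed.

(** The multiplier is the penalty weight times the constraint value, read off
    at the random iterate.  Young's inequality with parameter [gam] turns the
    bound on the mean squares of the residuals into one on their means. *)
Lemma run_complexity (khat : nat -> Omega -> nat) :
  (forall K, (1 <= K)%N -> uniform_index P xi K (khat K)) ->
  exists C p : R, [/\ 0 < C, 0 < p &
    forall eps : R, 0 < eps <= 1 / 2 ->
    exists K : nat, [/\ (1 <= K)%N,
      K%:R <= C * eps ^- 4 * (ln (1 / eps)) `^ p &
      exists lam : Omega -> 'rV[R]_m,
        [/\ forall i, measurable_fun setT (fun w => lam w 0 i),
          ('E_P[fun w => let y := x (khat K w).+1 w in
                  dist (grad f y + lam w *m jac c y)%R (neg_normal_cone X y)]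
             <= eps%:E)%E &
          ('E_P[fun w => enorm (c (x (khat K w).+1 w))] <= eps%:E)%E ]]].
Proof.
move=> khat_unif; have [C [q [C0 hq hC]]] := residual_moments.
have dr0 : 0 < delta * rho by rewrite mulr_gt0.
pose tau := Num.min 1 (delta * rho).
have tau0 : 0 < tau by rewrite lt_min ltr01.
have [D D0 hD] := iteration_count C0 tau0.
exists D, 2; split => // eps eps_itv.
have [K [K1 KD KC]] := hD eps eps_itv; have /andP[e0 _] := eps_itv.
exists K; split => //.
pose gam := tau * eps; have gam0 : 0 < gam by rewrite mulr_gt0.
have K0 : 0 < K%:R :> R by rewrite ltr0n.
pose W k w := gam / 2 + (2 * gam)^-1 * run_residual k w ^+ 2.
have Wge k w : run_residual k w <= W k w.
  rewrite -subr_ge0.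
  have -> : W k w - run_residual k w = (run_residual k w - gam) ^+ 2 / (2 * gam).
    by rewrite /W; field; rewrite gt_eqF.
  by rewrite divr_ge0 ?sqr_ge0 // mulr_ge0 // ltW.
have W0 k w : 0 <= W k w := le_trans (run_residual_ge0 k w) (Wge k w).
have mW k : measurable_fun (setT : set (past xi k.+1)) (W k).
  apply: measurable_funD => //; apply: measurable_funM => //.
  by apply: measurable_funX; exact: run_residual_measurable.
have hW k := has_meanD (has_mean_cst P (gam / 2)) (has_meanZ (2 * gam)^-1 (hq k)).
have avg : K%:R^-1 * (\sum_(k < K) (gam / 2 + (2 * gam)^-1 * q k)) <= gam.
  rewrite big_split /= sumr_const card_ord -mulr_sumr -[_ *+ K]mulr_natl.
  have hS := le_trans (hC K K1) KC; move: (\sum_(k < K) q k) hS => S hS.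
  rewrite -/gam in hS.
  have g2 : 0 < 2 * gam by rewrite mulr_gt0.
  have h1 : (2 * gam)^-1 * S <= gam / 2 * K%:R.
    by rewrite [_^-1 * S]mulrC ler_pdivrMr //; lra.
  by rewrite [_^-1 * (_ + _)]mulrC ler_pdivrMr //; lra.
have uK := khat_unif K K1; have [mk _ _] := uK.
exists (fun w => rho_ rho (khat K w) *: c (x (khat K w).+1 w)); split.
- by move=> i; exact: multiplier_measurable.
- rewrite unlock.
  apply: le_trans (index_mean xi_iid K1 uK mW W0 hW _ _) _.
  + by move=> w; rewrite lee_fin; exact: dist_ge0.
  + apply: aeW => w k E; rewrite lee_fin /= E.
    exact: le_trans (run_residual_stationarity k w) (Wge k w).
  + by rewrite lee_fin (le_trans avg) // /gam ler_piMl ?(ltW e0) // ge_min lexx.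
- rewrite unlock.
  pose V k w := (delta * rho)^-1 * W k w.
  have mV k : measurable_fun (setT : set (past xi k.+1)) (V k).
    exact: measurable_funM.
  have V0 k w : 0 <= V k w by rewrite mulr_ge0 // invr_ge0 ltW.
  have hV k := has_meanZ (delta * rho)^-1 (hW k).
  apply: le_trans (index_mean xi_iid K1 uK mV V0 hV _ _) _.
  + by move=> w; rewrite lee_fin; exact: enorm_ge0.
  + apply: filterS run_residual_feasibility => w feas k E; rewrite lee_fin E.
    rewrite /V mulrC ler_pdivlMr // mulrC.
    exact: le_trans (feas k) (Wge k w).
  + rewrite lee_fin -mulr_sumr mulrCA mulrC ler_pdivrMr //.
    by rewrite (le_trans avg) // /gam mulrC ler_wpM2l ?(ltW e0) // ge_min lexx orbT.
Qed.

End convergence.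

End stochastic_run.

(** * The complexity bound *)

Theorem theorem4p2 (R : realType) (d m : nat)
  (* the problem *)
  (X : set 'rV[R]_d) (f : 'rV[R]_d -> R) (c : 'rV[R]_d -> 'rV[R]_m)
  (X_closed : closed X)
  (X_convex : convex_set (X : set (convex_lmodType 'rV[R]_d)))
  (f_diff : forall x, differentiable f x)
  (f_smooth : exists L : R,
     forall x y, enorm (grad f x - grad f y) <= L * enorm (x - y))
  (c_diff : forall x, differentiable c x)
  (* the sample space, the objective and the stochastic oracle *)
  (dX : measure_display) (Xi : measurableType dX) (mu : probability Xi R)
  (ftilde : 'rV[R]_d -> Xi -> R)
  (ftilde_int : forall x, mu.-integrable setT (EFin \o ftilde x))
  (f_mean : forall x, ('E_mu[ftilde x] = (f x)%:E)%E)
  (G : 'rV[R]_d -> Xi -> 'rV[R]_d)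
  (G_meas : forall j : 'I_d, measurable_fun setT
     (fun z : borel_rV R d * Xi => G z.1 z.2 0 j))
  (G_unbiased : forall x (j : 'I_d),
     ('E_mu[fun s => G x s 0%R j] = (grad f x 0%R j)%:E)%E)
  (* the constants *)
  (Lf Lgc Lc sigmaf Cgc Cc Cgf Bf delta Qlow rho : R)
  (Lf_gt0 : 0 < Lf) (Lgc_gt0 : 0 < Lgc) (Lc_gt0 : 0 < Lc)
  (sigmaf_gt0 : 0 < sigmaf) (Cgc_gt0 : 0 < Cgc) (Cc_gt0 : 0 < Cc)
  (Cgf_gt0 : 0 < Cgf) (Bf_gt0 : 0 < Bf) (delta_gt0 : 0 < delta)
  (rho_gt1 : 1 < rho)
  (* (i) *)
  (G_lip : forall x y,
     ('E_mu[fun s => (enorm (G x s - G y s) ^+ 2)%R]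
        <= (Lf ^+ 2 * enorm (x - y)%R ^+ 2)%:E)%E)
  (gc_lip : forall x y, opnorm (jac c x - jac c y) <= Lgc * enorm (x - y))
  (c_lip : forall x y, enorm (c x - c y) <= Lc * enorm (x - y))
  (* (ii) *)
  (G_var : forall x,
     ('E_mu[fun s => (enorm (G x s - grad f x) ^+ 2)%R] <= (sigmaf ^+ 2)%:E)%E)
  (* (iii), except for the bound on the iterates *)
  (gc_bound : forall x, opnorm (jac c x) <= Cgc)
  (c_bound : forall x, enorm (c x) <= Cc)
  (gf_bound : forall x, enorm (grad f x) <= Cgf)
  (Q_bound : forall r x, 0 < r -> Qlow <= penalty f c r x)
  (* the probability space, the samples and the run *)
  (dO : measure_display) (Omega : measurableType dO) (P : probability Omega R)
  (xi : nat -> Omega -> Xi) (xi_iid : iid_samples P mu xi)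
  (x1 : 'rV[R]_d) (x1_in : X x1)
  (x g : nat -> Omega -> 'rV[R]_d)
  (run : forall w, slqp_run X G c (eta_ (Ltilde m Lf Lgc Lc Cgc Cc) rho)
     (rho_ rho) alpha_ x1 (xi ^~ w) (x ^~ w) (g ^~ w))
  (* (iii), the bound on the iterates, and (iv) *)
  (f_bound : \forall w \ae P, forall k, (1 <= k)%N -> `|f (x k w)| <= Bf)
  (c_reg : \forall w \ae P, forall k, (1 <= k)%N ->
     delta * enorm (c (x k w))
       <= dist (c (x k w) *m jac c (x k w)) (neg_normal_cone X (x k w)))
  (* for each K, a random index drawn from {1, ..., K} *)
  (khat : nat -> Omega -> nat)
  (khat_unif : forall K, (1 <= K)%N -> uniform_index P xi K (khat K)) :
  exists C p : R, [/\ 0 < C, 0 < p &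
    forall eps : R, 0 < eps <= 1 / 2 ->
    exists K : nat, [/\ (1 <= K)%N,
      K%:R <= C * eps ^- 4 * (ln (1 / eps)) `^ p &
      exists lam : Omega -> 'rV[R]_m,
        [/\ forall i, measurable_fun setT (fun w => lam w 0 i),
          ('E_P[fun w => let y := x (khat K w).+1 w in
                  dist (grad f y + lam w *m jac c y)%R (neg_normal_cone X y)]
             <= eps%:E)%E &
          ('E_P[fun w => enorm (c (x (khat K w).+1 w))] <= eps%:E)%E ]]].
Proof.
exact: (run_complexity X_closed X_convex c_diff G_meas G_unbiased Lf_gt0 Lgc_gt0
  Lc_gt0 Cgc_gt0 Cc_gt0 rho_gt1 G_lip gc_lip c_lip G_var gc_bound c_bound gf_bound
  xi_iid x1_in run f_diff delta_gt0 Q_bound c_reg khat_unif).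
Qed.
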